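(* Let $\bar H:G\times\mathfrak g^*\to\mathbb R$ be a Hamiltonian function. The Morse family $$E^{\bar H\to\bar L}(g,\xi,\mu)=\langle\mu,\xi\rangle-\bar H(g,\mu)$$ defined on the trivialized Pontryagin bundle ${}^1PG=G\times(\mathfrak g\times\mathfrak g^* )$ over $G\times\mathfrak g$ (projection $(g,\xi,\mu)\mapsto(g,\xi)$) determines the Lagrangian submanifold $$S'=\left\{\left(g,\mu,\frac{\delta\bar H}{\delta\mu},-T_e^*R_g\frac{\delta\bar H}{\delta g}\right)\in{}^1TT^*G:(g,\mu)\in G\times\mathfrak g^*\right\}.$$ That is, $E^{\bar H\to\bar L}$ is a Morse family, and if $S_{T^*(G\times\mathfrak g)}$ is the Lagrangian submanifold of $T^*(G\times\mathfrak g)$ it generates, then $$({}^1\bar\sigma_G)^{-1}\big(tr^1(S_{T^*(G\times\mathfrak g)})\big)=S'.$$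
   Context: $G$ is a Lie group with identity $e$, and $\mathfrak g\simeq T_eG$ is its Lie algebra, assumed reflexive ($\mathfrak g^{**}=\mathfrak g$), with dual $\mathfrak g^*$. $R_g$ is right multiplication. The bracket on $\mathfrak g$ is that of right invariant vector fields: $X^G_{[\xi,\eta]}=[X^G_\xi,X^G_\eta]_{JL}$ (Jacobi-Lie bracket), where $X^G_\xi(g)=T_eR_g\xi$. $\langle ad^*_\xi\mu,\eta\rangle=\langle\mu,[\xi,\eta]\rangle$. $T_e^*R_g:T_g^*G\to\mathfrak g^*$ is the dual of $T_eR_g$. $\delta\bar H/\delta g\in T_g^*G$ and $\delta\bar H/\delta\mu\in\mathfrak g$ are partial derivatives. ${}^1TT^*G=(G\times\mathfrak g^* )\times(\mathfrak g\times\mathfrak g^* )$ with points $(g,\mu,\xi,\nu)$, at which every tangent vector is uniquely $$X_{(\xi_2,\nu_2,\xi_3,\nu_3)}=(T_eR_g\xi_2,\nu_2+ad^*_{\xi_2}\mu,\xi_3+[\xi,\xi_2],\nu_3+ad^*_{\xi_2}\nu-ad^*_\xi\nu_2),$$ with $\xi_2,\xi_3\in\mathfrak g$ and $\nu_2,\nu_3\in\mathfrak g^*$. The symplectic form on ${}^1TT^*G$ is $d\theta_2$, where $\langle\theta_2,X_{(\xi_2,\nu_2,\xi_3,\nu_3)}\rangle=\langle\mu,\xi_3\rangle+\langle\nu,\xi_2\rangle+\langle\mu,[\xi,\xi_2]\rangle$. ${}^1T^*TG=(G\times\mathfrak g)\times(\mathfrak g^*\times\mathfrak g^* )$. The trivialization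 of $T^*(G\times\mathfrak g)$ is $$tr^1:T^*(G\times\mathfrak g)\to{}^1T^*TG,\quad(\alpha_g,\alpha_\xi)\in T^*_{(g,\xi)}(G\times\mathfrak g)\mapsto(g,\xi,T_e^*R_g\alpha_g+ad^*_\xi\alpha_\xi,\alpha_\xi),$$ and $${}^1\bar\sigma_G:{}^1TT^*G\to{}^1T^*TG,\quad(g,\mu,\xi,\nu)\mapsto(g,\xi,\nu+ad^*_\xi\mu,\mu).$$ Morse families: for a fibre bundle $\pi:\mathcal P\to\mathcal M$, let $V\mathcal P=\ker T\pi$ and let $V^0\mathcal P\subset T^*\mathcal P$ be the covectors annihilating $V\mathcal P$. A function $E:\mathcal P\to\mathbb R$ is a Morse family if $T_z\,\mathrm{im}(dE)+T_zV^0\mathcal P=T_zT^*\mathcal P$ for all $z\in\mathrm{im}(dE)\cap V^0\mathcal P$. It generates the (immersed) Lagrangian submanifold $\{\lambda\in T^*_x\mathcal M:\ x\in\mathcal M,\ \exists\,p\in\pi^{-1}(x)\text{ with }(T_p\pi)^*\lambda=dE(p)\}$ of $T^*\mathcal M$. *)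

(* Defs.v *)
From HB Require Import structures.
From mathcomp Require Import all_boot all_order all_algebra.
From mathcomp Require Import all_classical all_reals.
From mathcomp Require Import topology normedtype derive.
Set Implicit Arguments.
Unset Strict Implicit.
Unset Printing Implicit Defensive.
Import Order.TTheory GRing.Theory Num.Theory.
Import numFieldNormedType.Exports.
Local Open Scope classical_set_scope.
Local Open Scope ring_scope.

Section ContinuousLinearMaps.
Context {R : realType} (E F : normedModType R).

Definition clin_pred : {pred E -> F} :=
  fun f => `[< linear f /\ continuous f >].

Lemma clin_submod : submod_closed clin_pred.
Proof.
split; first by apply/asboolP; split => [a x y|x];
  [rewrite scaler0 addr0 | exact: cst_continuous].
move=> a f g /asboolP[fl fc] /asboolP[gl gc]; apply/asboolP; split.
  move=> b x y; rewrite !fctE/= fl gl !scalerDr !scalerA -!addrA; congr (_ + _).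
    by rewrite mulrC.
  by rewrite addrCA.
move=> x; apply: cvgD; last exact: gc.
by apply: cvgZ; [exact: cvg_cst | exact: fc].
Qed.

HB.instance Definition _ := GRing.isSubmodClosed.Build R (E -> F) clin_pred
  clin_submod.

Record clin := Clin { clin_fun :> E -> F; _ : clin_fun \in clin_pred }.

HB.instance Definition _ := [isSub for clin_fun].
HB.instance Definition _ := [Choice of clin by <:].
HB.instance Definition _ := [SubChoice_isSubLmodule of clin by <:].

Lemma clin_linear (f : clin) : linear f.
Proof. by case: f => f /= /asboolP[]. Qed.
HB.instance Definition _ (f : clin) :=
  GRing.isLinear.Build R E F *:%R f (clin_linear f).

Lemma clin_continuous (f : clin) : continuous f.
Proof. by case: f => f /= /asboolP[]. Qed.

Definition clin_norm (f : clin) : R :=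
  sup [set `|f x| | x in [set x : E | `|x| <= 1]].

Lemma clin_has_sup (f : clin) :
  has_sup [set `|f x| | x in [set x : E | `|x| <= 1]].
Proof.
split; first by exists `|f 0|, 0 => //=; rewrite normr0.
have /linear_boundedP : bounded_near f (nbhs (0 : E)).
  by apply: continuous_linear_bounded; exact: clin_continuous.
case/pinfty_ex_gt0 => M M0 fM; exists M => _ [x /= x1 <-].
by rewrite (le_trans (fM x))// ler_piMr// ltW.
Qed.

Lemma clin_norm_le (f : clin) (x : E) : `|f x| <= clin_norm f * `|x|.
Proof.
have [->|x0] := eqVneq x 0; first by rewrite linear0 !normr0 mulr0.
have nx : 0 < `|x| by rewrite normr_gt0.
rewrite -ler_pdivrMr//.
apply: ub_le_sup; first by case: (clin_has_sup f).
exists (`|x|^-1 *: x) => /=.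
  by rewrite normrZ normfV normr_id mulVf// normr_eq0.
by rewrite linearZ/= normrZ normfV normr_id mulrC.
Qed.

Lemma clin_norm_ler (f : clin) (M : R) :
  (forall x, `|x| <= 1 -> `|f x| <= M) -> clin_norm f <= M.
Proof.
move=> fM; apply: ge_sup; first by case: (clin_has_sup f).
by move=> _ [x /= x1 <-]; exact: fM.
Qed.

Lemma clin_norm_ge0 (f : clin) : 0 <= clin_norm f.
Proof.
apply: ub_le_sup; first by case: (clin_has_sup f).
by exists 0 => /=; rewrite ?normr0// linear0 normr0.
Qed.

Lemma clin_normD (f g : clin) : clin_norm (f + g) <= clin_norm f + clin_norm g.
Proof.
apply: clin_norm_ler => x x1 /=; rewrite (le_trans (ler_normD _ _))//.
by apply: lerD; rewrite (le_trans (clin_norm_le _ _))// ler_piMr// clin_norm_ge0.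
Qed.

Lemma clin_normZ (a : R) (f : clin) : clin_norm (a *: f) = `|a| * clin_norm f.
Proof.
apply/eqP; rewrite eq_le; apply/andP; split.
  apply: clin_norm_ler => x x1 /=; rewrite normrZ ler_wpM2l//.
  by rewrite (le_trans (clin_norm_le _ _))// ler_piMr// clin_norm_ge0.
have [->|a0] := eqVneq a 0; first by rewrite normr0 mul0r clin_norm_ge0.
rewrite mulrC -ler_pdivlMr ?normr_gt0//; apply: clin_norm_ler => x x1.
rewrite ler_pdivlMr ?normr_gt0// mulrC -normrZ.
apply: le_trans (clin_norm_le (a *: f) x) _.
by rewrite ler_piMr// clin_norm_ge0.
Qed.

Lemma clin_norm0_eq0 (f : clin) : clin_norm f = 0 -> f = 0.
Proof.
move=> f0; apply/val_inj/funext => x; apply/eqP.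
by have := clin_norm_le f x; rewrite f0 mul0r normr_le0.
Qed.

HB.instance Definition _ :=
  Lmodule_isNormed.Build R clin clin_normD clin_normZ clin_norm0_eq0.

(* Packs a function as a continuous linear map; 0 if it is not one. *)
Definition mkclin (f : E -> F) : clin := insubd 0 f.

End ContinuousLinearMaps.

Definition dual (R : realType) (E : normedModType R) : normedModType R :=
  clin E R.

(* The canonical map from E to its bidual is onto. *)
Definition reflexive_space (R : realType) (E : normedModType R) : Prop :=
  forall phi : dual (dual E), exists xi : E, forall mu : dual E, phi mu = mu xi.

(* Frechet class C^k on U (meant for open U): the derivative is a map into the
   space of continuous linear maps with the operator norm. *)
Fixpoint Ck (R : realType) (k : nat) (E F : normedModType R) (U : set E)
    (f : E -> F) {struct k} : Prop :=
  match k with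
  | 0 => forall x, U x -> {for x, continuous f}
  | k'.+1 => (forall x, U x -> differentiable f x) /\
             Ck k' U (fun x => mkclin ('d f x) : clin E F)
  end.

Definition smooth_on (R : realType) (E F : normedModType R) (U : set E)
  (f : E -> F) : Prop := forall k, Ck k U f.

(* An atlas on the set T modelled on E, indexed by the points of T: every point
   p comes with a chart around p, of domain dom p, with inverse unchart p. As in
   Lang's definition of a Banach manifold, the topology of T is the one
   generated by the charts.
   The tangent space at p is represented by E through the chart of index p, so
   that the cotangent space at p is represented by dual E. *)
Record atlas (R : realType) (T : Type) (E : normedModType R) := Atlas {
  dom : T -> set T;
  chart : T -> T -> E;
  unchart : T -> E -> T
}.

Section Manifolds.
Context {R : realType}.

Record is_manifold (T : Type) (E : normedModType R) (A : atlas T E) : Prop := {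
  dom_self : forall p, dom A p p;
  chartK : forall p q, dom A p q -> unchart A p (chart A p q) = q;
  open_chart : forall p, open (chart A p @` dom A p);
  open_overlap : forall p q, open (chart A p @` (dom A p `&` dom A q));
  smooth_transition : forall p q,
    smooth_on (chart A p @` (dom A p `&` dom A q)) (chart A q \o unchart A p)
}.

Definition vec_atlas (E : normedModType R) : atlas E E :=
  Atlas (fun=> setT) (fun=> id) (fun=> id).

Definition prod_atlas (T T' : Type) (E E' : normedModType R)
    (A : atlas T E) (A' : atlas T' E') : atlas (T * T') (E * E')%type :=
  Atlas (fun p => dom A p.1 `*` dom A' p.2)
        (fun p q => (chart A p.1 q.1, chart A' p.2 q.2))
        (fun p x => (unchart A p.1 x.1, unchart A' p.2 x.2)).

Section Maps.
Context (T T' : Type) (E E' : normedModType R).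
Variables (A : atlas T E) (A' : atlas T' E').

Definition smooth (f : T -> T') : Prop := forall p, exists U : set E,
  [/\ open U, U (chart A p p), U `<=` chart A p @` dom A p,
      forall x, U x -> dom A' (f p) (f (unchart A p x)) &
      smooth_on U (chart A' (f p) \o f \o unchart A p)].

(* T_p f *)
Definition tmap (f : T -> T') (p : T) : clin E E' :=
  mkclin ('d (chart A' (f p) \o f \o unchart A p) (chart A p p)).

End Maps.

Section OneManifold.
Context (T : Type) (E : normedModType R).
Variable A : atlas T E.

(* Differential of a real function, as a covector at p. *)
Definition dfun (f : T -> R) (p : T) : dual E := tmap A (vec_atlas R) f p.

(* tcoord q p r : change of representative, from the chart of index q to the
   chart of index p, for the tangent vectors at r. *)
Definition tcoord (q p r : T) : clin E E :=
  mkclin ('d (chart A p \o unchart A q) (chart A q r)).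

(* Velocities at p of the curves in S through p; for a submanifold S, this is
   its tangent space. *)
Definition tangent (S : set T) (p : T) : set E :=
  [set v | exists c : R -> T, [/\ c 0 = p,
    \forall t \near (0 : R), S (c t) /\ dom A p (c t) &
    is_derive (0 : R) (1 : R) (chart A p \o c) v]].

Definition submanifold (S : set T) : Prop := forall p, S p ->
  exists (F1 F2 : normedModType R) (U : set E) (V : set (F1 * F2)%type)
    (Phi : E -> (F1 * F2)%type) (Psi : (F1 * F2)%type -> E),
  [/\ open U, U (chart A p p) & U `<=` chart A p @` dom A p] /\
  [/\ open V, Phi @` U = V & {in U, cancel Phi Psi}] /\
  [/\ smooth_on U Phi, smooth_on V Psi &
      forall x, U x -> (S (unchart A p x) <-> (Phi x).2 = 0)].

(* Cotangent bundle; its charts are the cotangent lifts of the charts of T. *)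
Definition cotangent_atlas : atlas (T * dual E)%type (E * dual E)%type :=
  Atlas (fun z => dom A z.1 `*` setT)
    (fun z (w : T * dual E) =>
       (chart A z.1 w.1, mkclin (w.2 \o tcoord z.1 w.1 w.1)))
    (fun z (w : E * dual E) => let q := unchart A z.1 w.1 in
       (q, mkclin (w.2 \o tcoord q z.1 q))).

(* Jacobi-Lie bracket of vector fields: [X, Y] = DY.X - DX.Y in charts. *)
Definition local_vf (X : T -> E) (p : T) (x : E) : E :=
  let q := unchart A p x in tcoord q p q (X q).

Definition jacobi_lie (X Y : T -> E) (p : T) : E :=
  'd (local_vf Y p) (chart A p p) (X p) - 'd (local_vf X p) (chart A p p) (Y p).

(* Exterior derivative of a one-form. *)
Definition local_form (theta : T -> dual E) (p : T) (v : E) (x : E) : R :=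
  let q := unchart A p x in theta q (tcoord p q q v).

Definition ext_deriv (theta : T -> dual E) (p : T) (u v : E) : R :=
  'd (local_form theta p v) (chart A p p) u -
  'd (local_form theta p u) (chart A p p) v.

Definition lagrangian (omega : T -> E -> E -> R) (S : set T) : Prop :=
  submanifold S /\ forall p, S p -> forall v,
    tangent S p v <-> (forall u, tangent S p u -> omega p u v = 0).

End OneManifold.

Section MorseFamilies.
Context (P M : Type) (EP EM : normedModType R).
Variables (AP : atlas P EP) (AM : atlas M EM) (pi : P -> M) (E : P -> R).

Definition image_dfun : set (P * dual EP) :=
  [set z | z.2 = dfun AP E z.1].

Definition vertical_annihilator : set (P * dual EP) :=
  [set z : P * dual EP | forall v, tmap AP AM pi z.1 v = 0 -> z.2 v = 0].

Definition morse_family : Prop :=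
  smooth AP (vec_atlas R) E /\
  forall z, image_dfun z -> vertical_annihilator z ->
  forall w, exists a b,
    [/\ tangent (cotangent_atlas AP) image_dfun z a,
        tangent (cotangent_atlas AP) vertical_annihilator z b & w = a + b].

Definition generated : set (M * dual EM) :=
  [set l : M * dual EM | exists2 p, pi p = l.1 &
    forall v, l.2 (tmap AP AM pi p v) = dfun AP E p v].

End MorseFamilies.

Section LieGroups.
Context (G : groupType) (E : normedModType R).
Variable A : atlas G E.

(* The topology generated by an atlas is T1, so that G is Hausdorff. *)
Definition lie_group : Prop :=
  [/\ is_manifold A,
      smooth (prod_atlas A A) A (fun x => (x.1 * x.2)%g) &
      smooth A A (fun x => x^-1%g)].

(* T_e R_g and its dual *)
Definition TeR (g : G) : clin E E := tmap A A (fun h => (h * g)%g) 1%g.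

Definition TeR_star (g : G) (alpha : dual E) : dual E :=
  mkclin (alpha \o TeR g).

Definition right_inv_vf (xi : E) (g : G) : E := TeR g xi.

(* The value at e of X_[xi, eta] = [X_xi, X_eta]. *)
Definition lie_bracket (xi eta : E) : E :=
  jacobi_lie A (right_inv_vf xi) (right_inv_vf eta) 1%g.

Definition ad_star (xi : E) (mu : dual E) : dual E :=
  mkclin (fun eta => mu (lie_bracket xi eta)).

Definition TTsG := ((G * dual E) * (E * dual E))%type.
Definition TsTG := ((G * E) * (dual E * dual E))%type.

Definition TTsG_model : normedModType R := ((E * dual E) * (E * dual E))%type.

Definition TTsG_atlas : atlas TTsG TTsG_model :=
  prod_atlas (prod_atlas A (vec_atlas (dual E)))
             (prod_atlas (vec_atlas E) (vec_atlas (dual E))).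

(* X_(xi2, nu2, xi3, nu3) at (g, mu, xi, nu) *)
Definition TTsG_vec (z : TTsG) (xi2 : E) (nu2 : dual E) (xi3 : E)
    (nu3 : dual E) : TTsG_model :=
  let: ((g, mu), (xi, nu)) := z in
  ((TeR g xi2, nu2 + ad_star xi2 mu),
   (xi3 + lie_bracket xi xi2, nu3 + ad_star xi2 nu - ad_star xi nu2)).

(* Every w is TTsG_vec z xi2 nu2 xi3 nu3 for a unique (xi2, nu2, xi3, nu3). *)
Definition theta2 (z : TTsG) : dual TTsG_model :=
  let: ((g, mu), (xi, nu)) := z in
  mkclin (fun w => get [set r | exists xi2 nu2 xi3 nu3,
    w = TTsG_vec z xi2 nu2 xi3 nu3 /\
    r = mu xi3 + nu xi2 + mu (lie_bracket xi xi2)]).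

Definition TG_atlas : atlas (G * E) (E * E)%type := prod_atlas A (vec_atlas E).

(* alpha = (alpha_g, alpha_xi) is split along T_g G x T_xi g *)
Definition tr1 (z : (G * E) * dual (E * E)%type) : TsTG :=
  let: ((g, xi), alpha) := z in
  let alpha_g : dual E := mkclin (fun v => alpha (v, 0)) in
  let alpha_xi : dual E := mkclin (fun v => alpha (0, v)) in
  ((g, xi), (TeR_star g alpha_g + ad_star xi alpha_xi, alpha_xi)).

Definition sigmaG (z : TTsG) : TsTG :=
  let: ((g, mu), (xi, nu)) := z in ((g, xi), (nu + ad_star xi mu, mu)).

Definition PG_atlas : atlas (G * (E * dual E)) (E * (E * dual E))%type :=
  prod_atlas A (prod_atlas (vec_atlas E) (vec_atlas (dual E))).

Definition PG_proj (p : G * (E * dual E)) : G * E := (p.1, p.2.1).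

Section Hamiltonian.
Variable H : G * dual E -> R.

Definition morse_energy (p : G * (E * dual E)) : R :=
  let: (g, (xi, mu)) := p in mu xi - H (g, mu).

Definition dH_dg (g : G) (mu : dual E) : dual E :=
  dfun A (fun h => H (h, mu)) g.

(* The partial derivative in mu is a point of dual (dual E), identified with a
   point of E. *)
Definition dH_dmu (g : G) (mu : dual E) : E :=
  xget 0 [set xi | forall nu : dual E,
    dfun (vec_atlas (dual E)) (fun mu' => H (g, mu')) mu nu = nu xi].

Definition S' : set TTsG :=
  range (fun x : G * dual E =>
    (x, (dH_dmu x.1 x.2, - TeR_star x.1 (dH_dg x.1 x.2)))).

End Hamiltonian.
End LieGroups.
End Manifolds.

Arguments PG_proj {R G E} p.

(* Main.v *)
From HB Require Import structures.
Require Import Defs.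
From mathcomp Require Import all_boot all_order all_algebra.
From mathcomp Require Import all_classical all_reals.
From mathcomp Require Import topology normedtype landau derive.
From mathcomp Require Import ring lra.
Set Implicit Arguments.
Unset Strict Implicit.
Unset Printing Implicit Defensive.
Import Order.TTheory GRing.Theory Num.Theory.
Import numFieldNormedType.Exports.
Local Open Scope classical_set_scope.
Local Open Scope ring_scope.

(** Everything happens in a chart of [G] with coordinate [y], in which [H] becomes a
    smooth function of [(y, mu)] on an open subset of a normed space, written
    [h] here.

    Morse family. The energy is [e (y, xi, mu) = <mu, xi> - h (y, mu)]. The vectors
    tangent to the image of [dE] include the pairs [(v, D^2 e v)], and those tangent
    to the annihilator of the vertical bundle include the pairs [(v, eta)] for which
    [eta] vanishes on the vertical vectors [(0, 0, c)]. To write a given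
    [(v', lambda')] as a sum one needs [v] such that
    [D^2 e v (0, 0, c) = lambda' (0, 0, c)] for all [c]. For [v = (0, xi, 0)] the left
    hand side is [c xi], so that [xi] exists by reflexivity
    ([energy_hessian], [morse_energy_family]).

    The set generated. The condition on a covector is
    [lambda (a, b) = <mu, b> + <c, xi> - dH (a, c)] for all [a], [b] and [c]. It
    says that [xi] is the derivative of [H] in [mu], that the second part of [lambda] is
    [mu] and that the first one is minus the derivative of [H] in [g]
    ([generated_energy]). Under the two trivializations the terms in [ad_star]
    cancel ([generated_energy_preimage]).

    Lagrangian submanifold. The brackets in [theta2] cancel, which leaves the one-form
    [<mu, d xi> + <nu, kappa>] with [kappa] the right invariant Maurer-Cartan form
    ([theta2E]). If [K y] is [kappa] in the chart, [S'] is the graph of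
    [F = (D_mu h, - D_y h o K^-1)], a smooth function of [(y, mu)]
    ([S'_local_graph]). Let [u] be tangent to this graph and [v] arbitrary, and let
    [(d1, d2)] be the difference between the last two components of [v] and [DF]
    applied to the first two. The value of the symplectic form at [u] and [v] is
    [u_mu d1 - d2 (K u_y)], as the other terms add up to
    [D^2 h (u, v) - D^2 h (v, u) = 0] ([omega_graph]). It vanishes for all [u] if
    and only if [d1] and [d2] vanish, that is if and only if [v] is tangent
    ([S'_lagrangian]).

    Three facts of analysis in Banach spaces enter: the closure of C^k maps under
    composition, which comes from the Leibniz rule for the evaluation of an operator
    ([Ck_eval]); the symmetry of the second derivative of a real function
    ([D2_sym]); and the Hahn-Banach theorem ([norming_functional]), by which [dH/dmu] is
    unique and, the inverse of the map into the bidual being bounded, depends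
    smoothly on the point ([reflexive_inverse]). On manifolds every computation with
    tangent vectors is an instance of one chain rule for derivatives read in arbitrary
    charts ([smooth_charts], [mder_comp]). *)

(** * Continuous linear maps *)

Section ContinuousLinearCalculus.
Context {R : realType}.
Implicit Types E F K : normedModType R.

Lemma clin_ext E F (f g : clin E F) : f =1 g -> f = g.
Proof. by move=> fg; apply/val_inj/funext. Qed.

Lemma clinD E F (f g : clin E F) x : (f + g) x = f x + g x. Proof. by []. Qed.
Lemma clinN E F (f : clin E F) x : (- f) x = - f x. Proof. by []. Qed.
Lemma clinZ E F a (f : clin E F) x : (a *: f) x = a *: f x. Proof. by []. Qed.
Lemma clin0 E F x : (0 : clin E F) x = 0. Proof. by []. Qed.
Lemma clin_mapD E F (f : clin E F) x y : f (x + y) = f x + f y. Proof. exact: linearD. Qed.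
Lemma clin_mapZ E F (f : clin E F) a x : f (a *: x) = a *: f x. Proof. exact: linearZ. Qed.
Lemma clin_map0 E F (f : clin E F) : f 0 = 0. Proof. exact: linear0. Qed.
Lemma clin_mapB E F (f : clin E F) x y : f (x - y) = f x - f y. Proof. exact: linearB. Qed.
Definition clinE := (clinD, clinN, clinZ, clin0).

Lemma clin_le E F (f : clin E F) x : `|f x| <= `|f| * `|x|.
Proof. exact: clin_norm_le. Qed.

Lemma mkclinE E F (f : E -> F) : linear f -> continuous f -> mkclin f = f :> (E -> F).
Proof.
by move=> fl fc; rewrite /mkclin [LHS]val_insubd ifT//; apply/asboolP.
Qed.

(* From here on both are used through their characteristic lemmas only. *)
#[global] Opaque mkclin diff.

Lemma mkclin_id E F (f : clin E F) : mkclin f = f.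
Proof.
by apply: clin_ext => x; rewrite mkclinE//; [exact: clin_linear|exact: clin_continuous].
Qed.

Lemma bounded_continuous E F (f : E -> F) (C : R) :
  linear f -> (forall x, `|f x| <= C * `|x|) -> continuous f.
Proof.
move=> fl fC.
pose fLM := GRing.isLinear.Build _ _ _ _ _ fl.
pose fL : {linear _ -> _} := HB.pack f fLM.
apply: (@bounded_linear_continuous _ _ _ fL).
apply/ex_bound; exists (Num.max C 0).
apply/nbhs_norm0P; exists 1 => //= x x1; apply: (le_trans (fC x)).
rewrite (@le_trans _ _ (Num.max C 0 * `|x|))//.
  by rewrite ler_wpM2r// le_max lexx.
by rewrite ler_piMr ?le_max ?lexx ?orbT// ltW.
Qed.

Lemma mkclin_bounded E F (f : E -> F) (C : R) :
  linear f -> (forall x, `|f x| <= C * `|x|) -> mkclin f = f :> (E -> F).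
Proof. by move=> fl /(bounded_continuous fl); exact: mkclinE. Qed.

Lemma clin_norm_bound E F (f : clin E F) (C : R) : 0 <= C ->
  (forall x, `|f x| <= C * `|x|) -> `|f| <= C.
Proof.
move=> C0 fC; apply: clin_norm_ler => x x1; apply: (le_trans (fC x)).
by rewrite ler_piMr.
Qed.

(** A bounded bilinear map in curried form. Curried, it is itself a continuous
    linear map, so that the smoothness of bilinear expressions reduces to that
    of the evaluation of an operator at a vector. *)
Definition mkbil E F K (B : E -> F -> K) : clin E (clin F K) :=
  mkclin (fun u => mkclin (B u)).

Lemma mkbilE E F K (B : E -> F -> K) (C : R) : 0 <= C ->
  (forall u, linear (B u)) -> (forall v, linear (B^~ v)) ->
  (forall u v, `|B u v| <= C * `|u| * `|v|) ->
  forall u v, mkbil B u v = B u v.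
Proof.
move=> C0 Br Bl BC u v.
have E1 w : mkclin (B w) = B w :> (F -> K) by apply: (mkclin_bounded (Br w)) => x; exact: BC.
rewrite /mkbil (@mkclin_bounded _ _ _ C) ?E1//.
- by move=> a x y; apply: clin_ext => w; rewrite /= !E1 Bl.
- move=> x; apply: clin_norm_bound => [|y]; first by rewrite mulr_ge0.
  by rewrite E1.
Qed.

Definition idclin E : clin E E := mkclin id.
Lemma idclinE E (x : E) : idclin E x = x.
Proof. by rewrite /idclin mkclinE// => y; exact: cvg_id. Qed.

Definition ccomp E F K (g : clin F K) (f : clin E F) : clin E K := mkclin (g \o f).

Lemma ccompE E F K (g : clin F K) (f : clin E F) x : ccomp g f x = g (f x).
Proof.
rewrite /ccomp mkclinE//; first by move=> a u v /=; rewrite !linearP.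
by move=> y; apply: continuous_comp; exact: clin_continuous.
Qed.

Lemma mkclin_comp E F K (g : clin F K) (f : clin E F) : mkclin (g \o f) = ccomp g f.
Proof. by []. Qed.

Lemma ccompA E F K L (h : clin K L) (g : clin F K) (f : clin E F) :
  ccomp h (ccomp g f) = ccomp (ccomp h g) f.
Proof. by apply: clin_ext => x; rewrite !ccompE. Qed.

Lemma ccompf1 E F (f : clin E F) : ccomp f (idclin E) = f.
Proof. by apply: clin_ext => x; rewrite ccompE idclinE. Qed.

Lemma ccomp_norm E F K (g : clin F K) (f : clin E F) : `|ccomp g f| <= `|g| * `|f|.
Proof.
apply: clin_norm_bound => [|x]; first by rewrite mulr_ge0.
rewrite ccompE -mulrA (le_trans (clin_le _ _))// ler_wpM2l//; exact: clin_le.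
Qed.

Definition comp_bil E F K : clin (clin F K) (clin (clin E F) (clin E K)) :=
  mkbil (@ccomp E F K).

Lemma comp_bilE E F K (g : clin F K) (f : clin E F) : comp_bil E F K g f = ccomp g f.
Proof.
apply: (@mkbilE _ _ _ _ 1) => //.
- by move=> u a x y; apply: clin_ext => z; rewrite clinE clinZ !ccompE clinE clin_mapD clin_mapZ.
- by move=> u a x y; apply: clin_ext => z; rewrite clinE clinZ !ccompE clinE.
- by move=> u v; rewrite mul1r; exact: ccomp_norm.
Qed.

Definition eval_bil E K : clin E (clin (clin E K) K) := mkbil (fun y (A : clin E K) => A y).

Lemma eval_bilE E K y (A : clin E K) : eval_bil E K y A = A y.
Proof.
apply: (@mkbilE _ _ _ _ 1) => //.
- by move=> v a x z; rewrite linearP.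
- by move=> u v; rewrite mul1r mulrC; exact: clin_le.
Qed.

Definition cfst E F : clin (E * F)%type E := mkclin fst.
Definition csnd E F : clin (E * F)%type F := mkclin snd.
Definition cinl E F : clin E (E * F)%type := mkclin (fun x => (x, 0)).
Definition cinr E F : clin F (E * F)%type := mkclin (fun x => (0, x)).

Lemma cfstE E F x : cfst E F x = x.1.
Proof. by rewrite /cfst mkclinE// => y; exact: cvg_fst. Qed.
Lemma csndE E F x : csnd E F x = x.2.
Proof. by rewrite /csnd mkclinE// => y; exact: cvg_snd. Qed.
Lemma cinlE E F x : cinl E F x = (x, 0).
Proof.
rewrite /cinl mkclinE//; first by move=> a u v; congr pair; rewrite /= scaler0 addr0.
by move=> y; apply: cvg_pair; [exact: cvg_id|exact: cvg_cst].
Qed.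
Lemma cinrE E F x : cinr E F x = (0, x).
Proof.
rewrite /cinr mkclinE//; first by move=> a u v; congr pair; rewrite /= scaler0 addr0.
by move=> y; apply: cvg_pair; [exact: cvg_cst|exact: cvg_id].
Qed.

Lemma pairD E F (x : E) (y : F) : (x, y) = (x, 0) + (0, y) :> E * F.
Proof. by congr pair; rewrite /= ?addr0 ?add0r. Qed.

End ContinuousLinearCalculus.

#[global] Opaque mkbil idclin ccomp comp_bil eval_bil cfst csnd cinl cinr.

(** * Differentials as continuous linear maps *)

Section Differentials.
Context {R : realType}.
Implicit Types E F K : normedModType R.

(** Without Landau symbols the definition of the differential visibly depends only on
    the map near the point. *)
Lemma has_diffP E F (f : E -> F) (x : E) (L : clin E F) :
  (differentiable f x /\ 'd f x = L :> (E -> F)) <->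
  (forall e : R, 0 < e -> \forall h \near (0 : E), `|f (h + x) - f x - L h| <= e * `|h|).
Proof.
have P : (f \o shift x = cst (f x) + L +o_ (0 : E) id) <->
  (forall e : R, 0 < e -> \forall h \near (0 : E), `|f (h + x) - f x - L h| <= e * `|h|).
  split.
    move=> /eqaddoP fx e e0; move: (fx e e0); apply: filterS => h /=.
    by rewrite !fctE/= opprD addrA.
  move=> fx; apply/eqaddoP => e e0; move: (fx e e0); apply: filterS => h /=.
  by rewrite !fctE/= opprD addrA.
rewrite -P; split.
  by move=> [/diff_locallyP[_ fx] <-].
move=> fx; have dE : 'd f x = L :> (E -> F).
  by apply: diff_unique => //; exact: clin_continuous.
split=> //; apply/diff_locallyP; split; last by rewrite dE.
by rewrite dE; exact: clin_continuous.
Qed.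

(** The differential as a bounded operator, the value that [Ck] iterates. *)
Definition D E F (f : E -> F) (x : E) : clin E F := mkclin ('d f x).

Lemma DE E F (f : E -> F) x : differentiable f x -> D f x = 'd f x :> (E -> F).
Proof. by move=> fx; rewrite /D mkclinE//; [exact: linearP|exact: diff_continuous]. Qed.

Lemma D_unique E F (f : E -> F) x (L : clin E F) :
  'd f x = L :> (E -> F) -> D f x = L.
Proof. by move=> fL; rewrite /D fL mkclin_id. Qed.

Lemma D_def E F (f : E -> F) x : D f x = mkclin ('d f x).
Proof. by []. Qed.
#[global] Opaque D.

Lemma near_differentiable E F (f g : E -> F) x : {near x, f =1 g} ->
  differentiable f x -> differentiable g x /\ D g x = D f x.
Proof.
move=> fg fx; have /has_diffP fD : differentiable f x /\ 'd f x = D f x :> (E -> F).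
  by rewrite DE.
suff [gx gD] : differentiable g x /\ 'd g x = D f x :> (E -> F).
  by split; [exact: gx|exact: D_unique gD].
apply/has_diffP => e e0.
have fg0 : \forall h \near (0 : E), f (h + x) = g (h + x).
  by move/(nbhs0P (fun y => f y = g y)): fg; apply: filterS => h; rewrite addrC.
move: (fD e e0) fg0; apply: filterS2 => h; move=> + <-.
by rewrite (nbhs_singleton fg).
Qed.

Lemma D_near E F (f g : E -> F) x : {near x, f =1 g} ->
  differentiable f x -> D f x = D g x.
Proof. by move=> fg fx; have [_ ->] := near_differentiable fg fx. Qed.

Lemma differentiable_clin E F (L : clin E F) x : differentiable L x.
Proof. exact/linear_differentiable/clin_continuous. Qed.

Lemma D_clin E F (L : clin E F) x : D L x = L.
Proof. by apply: D_unique; rewrite diff_lin//; exact: clin_continuous. Qed.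

Lemma D_cst E F (c : F) x : D (cst c : E -> F) x = 0.
Proof. by apply: D_unique; rewrite diff_cst. Qed.

Lemma D_add E F (f g : E -> F) x : differentiable f x -> differentiable g x ->
  D (f \+ g) x = D f x + D g x.
Proof.
move=> fx gx; apply: D_unique; rewrite (diffD fx gx).
apply/funext => y; rewrite [RHS]clinD.
by rewrite [D f x y](congr1 (@^~ y) (DE fx)) [D g x y](congr1 (@^~ y) (DE gx)).
Qed.

Lemma D_comp E F K (f : E -> F) (g : F -> K) x : differentiable f x ->
  differentiable g (f x) -> D (g \o f) x = ccomp (D g (f x)) (D f x).
Proof.
move=> fx gx; apply: D_unique; rewrite (diff_comp fx gx).
by apply/funext => y; rewrite ccompE (DE fx) (DE gx).
Qed.

Lemma D_pair E F K (f : E -> F) (g : E -> K) x v : differentiable f x ->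
  differentiable g x -> D (fun y => (f y, g y)) x v = (D f x v, D g x v).
Proof.
move=> fx gx; rewrite DE; last exact: differentiable_pair.
by rewrite (diff_pair fx gx) (DE fx) (DE gx).
Qed.

Lemma prod_norm_le1 E F (x : E * F) : `|x.1| <= `|x|.
Proof. by rewrite prod_normE le_max lexx. Qed.
Lemma prod_norm_le2 E F (x : E * F) : `|x.2| <= `|x|.
Proof. by rewrite prod_normE le_max lexx orbT. Qed.

(** Evaluation is bilinear: the remainder of its expansion at [p] is
    [h.1 h.2], of second order in [h]. *)
Lemma eval_diff E K (p : clin E K * E) :
  differentiable (fun q : clin E K * E => q.1 q.2) p /\
  forall q, D (fun q : clin E K * E => q.1 q.2) p q = p.1 q.2 + q.1 p.2.
Proof.
pose L : clin (clin E K * E)%type K :=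
  ccomp p.1 (csnd _ _) + ccomp (eval_bil _ _ p.2) (cfst _ _).
have LE q : L q = p.1 q.2 + q.1 p.2.
  by rewrite /L clinE !ccompE cfstE csndE eval_bilE.
pose f (q : clin E K * E) := q.1 q.2.
suff [dp pL] : differentiable f p /\ 'd f p = L :> (_ -> K).
  by split=> // q; rewrite -LE (D_unique pL).
apply/(has_diffP f p L) => e e0; rewrite /f; apply/nbhs_norm0P; exists e => //= h he.
have -> : (h + p).1 (h + p).2 - p.1 p.2 - L h = h.1 h.2.
  rewrite -[(h + p).1]/(h.1 + p.1) -[(h + p).2]/(h.2 + p.2) LE clinD !clin_mapD.
  by rewrite opprD !addrA !addrK.
rewrite (le_trans (clin_le _ _))// (@le_trans _ _ (`|h| * `|h|))//.
  by rewrite ler_pM// ?prod_norm_le1 ?prod_norm_le2.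
by rewrite ler_wpM2r// ltW.
Qed.

End Differentials.

(** * Maps of class C^k *)

Section CkCalculus.
Context {R : realType}.
Implicit Types E F K : normedModType R.

Lemma CkS E F k (U : set E) (f : E -> F) :
  Ck k.+1 U f <-> (forall x, U x -> differentiable f x) /\ Ck k U (D f).
Proof.
have -> : D f = fun x => mkclin ('d f x) by apply/funext => x; exact: D_def.
by split.
Qed.

Lemma Ck_sub E F k (U V : set E) (f : E -> F) : V `<=` U -> Ck k U f -> Ck k V f.
Proof.
elim: k F f => [|k IH] F f VU; first by move=> fU x /VU; exact: fU.
move=> /CkS[df Df]; apply/CkS; split; last exact: IH Df.
by move=> x /VU; exact: df.
Qed.

Lemma CkW E F k (U : set E) (h : E -> F) : Ck k.+1 U h -> Ck k U h.
Proof.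
elim: k F h => [|k IH] F h.
  by move=> /CkS[dh _] x /dh; exact: differentiable_continuous.
by move=> /CkS[dh Dh]; apply/CkS; split=> //; exact: IH.
Qed.

Lemma open_near E (U : set E) x : open U -> U x -> \forall y \near x, U y.
Proof. by move=> oU Ux; apply: open_nbhs_nbhs. Qed.

Lemma Ck_eq E F k (U : set E) (f g : E -> F) : open U ->
  (forall x, U x -> f x = g x) -> Ck k U f -> Ck k U g.
Proof.
move=> oU; elim: k F f g => [|k IH] F f g fg.
  move=> fU x Ux; have fx : f @ x --> f x by exact: fU.
  rewrite (fg x Ux) in fx; apply: cvg_trans fx.
  apply: near_eq_cvg; apply: filterS (open_near oU Ux) => y; exact: fg.
have fgx x : U x -> {near x, f =1 g}.
  by move=> Ux; apply: filterS (open_near oU Ux) => y; exact: fg.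
move=> /CkS[df Df]; apply/CkS; split=> [x Ux|].
  by have [] := near_differentiable (fgx x Ux) (df x Ux).
by apply: IH Df => x Ux; exact: D_near (fgx x Ux) (df x Ux).
Qed.

Lemma Ck_cst E F k (U : set E) (c : F) : Ck k U (cst c : E -> F).
Proof.
elim: k F c => [|k IH] F c; first by move=> x _; exact: cst_continuous.
apply/CkS; split=> [x _|]; first exact: differentiable_cst.
have -> : D (cst c : E -> F) = cst 0 by apply/funext => x; exact: D_cst.
exact: IH.
Qed.

Lemma Ck_clin E F k (U : set E) (L : clin E F) : Ck k U L.
Proof.
case: k => [|k]; first by move=> x _; exact: clin_continuous.
apply/CkS; split=> [x _|]; first exact: differentiable_clin.
have -> : D L = cst L by apply/funext => x; exact: D_clin.
exact: Ck_cst.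
Qed.

Lemma Ck_lin_comp E F K k (U : set E) (L : clin F K) (f : E -> F) : open U ->
  Ck k U f -> Ck k U (fun x => L (f x)).
Proof.
move=> oU; elim: k F K L f => [|k IH] F K L f.
  move=> fU x Ux; apply: (@continuous_comp _ _ _ f L); first exact: fU.
  exact: clin_continuous.
move=> /CkS[df Df]; apply/CkS; split=> [x Ux|].
  by apply: (@differentiable_comp _ _ _ _ f L); [exact: df|exact: differentiable_clin].
apply: (@Ck_eq _ _ _ _ (fun x => comp_bil E F K L (D f x))) => //; last exact: IH.
move=> x Ux; rewrite comp_bilE.
by rewrite [RHS](@D_comp _ _ _ _ f L) ?D_clin//; [exact: df|exact: differentiable_clin].
Qed.

Lemma Ck_add E F k (U : set E) (f g : E -> F) : open U ->
  Ck k U f -> Ck k U g -> Ck k U (fun x => f x + g x).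
Proof.
move=> oU; elim: k F f g => [|k IH] F f g.
  by move=> fU gU x Ux; apply: continuousD; [exact: fU|exact: gU].
move=> /CkS[df Df] /CkS[dg Dg]; apply/CkS; split=> [x Ux|].
  by apply: (@differentiableD _ _ _ f g); [exact: df|exact: dg].
apply: (@Ck_eq _ _ _ _ (fun x => D f x + D g x)) => //; last exact: IH.
by move=> x Ux; rewrite [RHS](@D_add _ _ _ f g)//; [exact: df|exact: dg].
Qed.

Lemma Ck_pair E F K k (U : set E) (f : E -> F) (g : E -> K) : open U ->
  Ck k U f -> Ck k U g -> Ck k U (fun x => (f x, g x)).
Proof.
move=> oU fU gU.
have -> : (fun x => (f x, g x)) = fun x => cinl F K (f x) + cinr F K (g x).
  by apply/funext => x; rewrite cinlE cinrE -pairD.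
by apply: Ck_add => //; exact: Ck_lin_comp.
Qed.

Lemma differentiable_eval E F K (f : E -> clin F K) (g : E -> F) x :
  differentiable f x -> differentiable g x ->
  differentiable (fun y => f y (g y)) x /\
  forall v, D (fun y => f y (g y)) x v = f x (D g x v) + D f x v (g x).
Proof.
move=> df dg.
have [de De] := eval_diff (f x, g x).
pose ev (q : clin F K * F) := q.1 q.2.
have dp : differentiable (fun y => (f y, g y)) x by exact: differentiable_pair.
split; first by apply: (@differentiable_comp _ _ _ _ (fun y => (f y, g y)) ev).
move=> v; rewrite (@D_comp _ _ _ _ (fun y => (f y, g y)) ev)// ccompE De.
by rewrite D_pair.
Qed.

(** Applying a varying operator to a varying vector preserves class C^k: by the
    Leibniz rule the derivative is a sum of two expressions of the same kind. All
    other closure properties of C^k maps follow from this one. *)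
Lemma Ck_eval E F K k (U : set E) (f : E -> clin F K) (g : E -> F) : open U ->
  Ck k U f -> Ck k U g -> Ck k U (fun x => f x (g x)).
Proof.
move=> oU; elim: k F K f g => [|k IH] F K f g.
  move=> fU gU x Ux; pose ev (q : clin F K * F) := q.1 q.2.
  apply: (@continuous_comp _ _ _ (fun y => (f y, g y)) ev).
    exact: (cvg_pair (fU x Ux) (gU x Ux)).
  by have [/differentiable_continuous] := eval_diff (f x, g x).
move=> fU gU; have [df Df] := (CkS _ _ _).1 fU; have [dg Dg] := (CkS _ _ _).1 gU.
apply/CkS; split=> [x Ux|].
  by have [] := differentiable_eval (df x Ux) (dg x Ux).
pose T : clin F (clin (clin E (clin F K)) (clin E K)) :=
  ccomp (comp_bil _ _ _) (eval_bil F K).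
apply: (@Ck_eq _ _ _ _ (fun x => comp_bil E F K (f x) (D g x) + T (g x) (D f x))) => //.
  move=> x Ux; apply: clin_ext => v.
  have [_ ->] := differentiable_eval (df x Ux) (dg x Ux).
  by rewrite clinD comp_bilE ccompE /T ccompE comp_bilE ccompE eval_bilE.
apply: Ck_add => //; apply: IH => //; apply: Ck_lin_comp => //; exact: CkW.
Qed.

(** By the chain rule the derivative of [g o f] is the composite operator
    [D g (f x) o D f x], bilinear in two maps of class C^k. *)
Lemma Ck_comp E F K k (U : set E) (V : set F) (f : E -> F) (g : F -> K) :
  open U -> (forall x, U x -> V (f x)) ->
  Ck k U f -> Ck k V g -> Ck k U (fun x => g (f x)).
Proof.
move=> oU fUV; elim: k K g => [|k IH] K g.
  by move=> fU gV x Ux; apply: (@continuous_comp _ _ _ f g); [exact: fU|exact/gV/fUV].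
move=> fU /CkS[dg Dg]; have [df Df] := (CkS _ _ _).1 fU.
apply/CkS; split=> [x Ux|].
  by apply: (@differentiable_comp _ _ _ _ f g); [exact: df|exact/dg/fUV].
apply: (@Ck_eq _ _ _ _ (fun x => comp_bil E F K (D g (f x)) (D f x))) => //.
  move=> x Ux; rewrite comp_bilE.
  by rewrite [RHS](@D_comp _ _ _ _ f g)//; [exact: df|exact/dg/fUV].
apply: Ck_eval => //; apply: Ck_lin_comp => //; apply: IH => //; exact: CkW.
Qed.

End CkCalculus.

Section SmoothCalculus.
Context {R : realType}.
Implicit Types E F K : normedModType R.

Lemma smooth_on_sub E F (U V : set E) (f : E -> F) :
  V `<=` U -> smooth_on U f -> smooth_on V f.
Proof. by move=> VU fU k; exact: Ck_sub (fU k). Qed.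

Lemma smooth_on_eq E F (U : set E) (f g : E -> F) : open U ->
  (forall x, U x -> f x = g x) -> smooth_on U f -> smooth_on U g.
Proof. by move=> oU fg fU k; exact: Ck_eq (fU k). Qed.

Lemma smooth_on_differentiable E F (U : set E) (f : E -> F) x :
  smooth_on U f -> U x -> differentiable f x.
Proof. by move=> /(_ 1)/CkS[df _]; exact: df. Qed.

Lemma smooth_on_continuous E F (U : set E) (f : E -> F) x :
  smooth_on U f -> U x -> {for x, continuous f}.
Proof. by move=> fU Ux; exact/differentiable_continuous/(smooth_on_differentiable fU). Qed.

Lemma smooth_on_D E F (U : set E) (f : E -> F) :
  smooth_on U f -> smooth_on U (D f).
Proof. by move=> fU k; have /CkS[] := fU k.+1. Qed.

Lemma smooth_on_cst E F (U : set E) (c : F) : smooth_on U (cst c : E -> F).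
Proof. by move=> k; exact: Ck_cst. Qed.

Lemma smooth_on_clin E F (U : set E) (L : clin E F) : smooth_on U L.
Proof. by move=> k; exact: Ck_clin. Qed.

Lemma smooth_on_id E (U : set E) : smooth_on U (fun x => x).
Proof.
have -> : (fun x : E => x) = idclin E by apply/funext => x; rewrite idclinE.
exact: smooth_on_clin.
Qed.

Lemma smooth_on_lin_comp E F K (U : set E) (L : clin F K) (f : E -> F) :
  open U -> smooth_on U f -> smooth_on U (fun x => L (f x)).
Proof. by move=> oU fU k; exact: Ck_lin_comp. Qed.

Lemma smooth_on_add E F (U : set E) (f g : E -> F) : open U ->
  smooth_on U f -> smooth_on U g -> smooth_on U (fun x => f x + g x).
Proof. by move=> oU fU gU k; exact: Ck_add. Qed.

Lemma smooth_on_opp E F (U : set E) (f : E -> F) : open U ->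
  smooth_on U f -> smooth_on U (fun x => - f x).
Proof.
move=> oU fU.
have -> : (fun x => - f x) = fun x => (- idclin F) (f x).
  by apply/funext => x; rewrite clinN idclinE.
exact: smooth_on_lin_comp.
Qed.

Lemma smooth_on_fst E F (U : set (E * F)%type) : smooth_on U fst.
Proof.
have -> : fst = cfst E F :> (_ -> _) by apply/funext => x; rewrite cfstE.
exact: smooth_on_clin.
Qed.

Lemma smooth_on_snd E F (U : set (E * F)%type) : smooth_on U snd.
Proof.
have -> : snd = csnd E F :> (_ -> _) by apply/funext => x; rewrite csndE.
exact: smooth_on_clin.
Qed.

Lemma smooth_on_pair E F K (U : set E) (f : E -> F) (g : E -> K) : open U ->
  smooth_on U f -> smooth_on U g -> smooth_on U (fun x => (f x, g x)).
Proof. by move=> oU fU gU k; exact: Ck_pair. Qed.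

Lemma smooth_on_eval E F K (U : set E) (f : E -> clin F K) (g : E -> F) : open U ->
  smooth_on U f -> smooth_on U g -> smooth_on U (fun x => f x (g x)).
Proof. by move=> oU fU gU k; exact: Ck_eval. Qed.

Lemma smooth_on_ccomp E F K L (U : set E) (f : E -> clin K L) (g : E -> clin F K) :
  open U -> smooth_on U f -> smooth_on U g -> smooth_on U (fun x => ccomp (f x) (g x)).
Proof.
move=> oU fU gU.
have -> : (fun x => ccomp (f x) (g x)) = fun x => comp_bil F K L (f x) (g x).
  by apply/funext => x; rewrite comp_bilE.
by apply: smooth_on_eval => //; exact: smooth_on_lin_comp.
Qed.

Lemma smooth_on_comp E F K (U : set E) (V : set F) (f : E -> F) (g : F -> K) :
  open U -> (forall x, U x -> V (f x)) ->
  smooth_on U f -> smooth_on V g -> smooth_on U (fun x => g (f x)).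
Proof. by move=> oU fUV fU gV k; exact: Ck_comp (gV k). Qed.

Lemma smooth_on_open_preimage E F (U : set E) (V : set F) (f : E -> F) :
  open U -> open V -> smooth_on U f -> open (U `&` f @^-1` V).
Proof.
move=> oU oV fU; rewrite openE => x [Ux Vfx]; rewrite /interior.
apply: filterI; first exact: open_nbhs_nbhs.
by apply: (smooth_on_continuous fU Ux); exact: open_nbhs_nbhs.
Qed.

End SmoothCalculus.

(** * Symmetry of the second derivative *)

Section SecondDerivative.
Context {R : realType} (E : normedModType R).

Definition second_difference (f : E -> R) (x u v : E) (s : R) : R :=
  f (x + s *: u + s *: v) - f (x + s *: u) - (f (x + s *: v) - f x).

Lemma second_differenceC f x u v s :
  second_difference f x u v s = second_difference f x v u s.
Proof.
by rewrite /second_difference [x + s *: u + _]addrAC; ring.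
Qed.

Lemma differentiable_line (x v : E) (t : R) :
  differentiable (fun t : R => x + t *: v) t /\
  'd (fun t : R => x + t *: v) t = (fun h => h *: v) :> (R -> E).
Proof.
have dv : is_diff t (cst x + *:%R^~ v) (0 + *:%R^~ v).
  exact: (is_diffD (is_diff_cst x t) (is_diff_scalel t v)).
by split; [exact: ex_diff|rewrite (@diff_val _ _ _ _ _ _ _ dv) add0r].
Qed.

Lemma is_derive_line (F : normedModType R) (f : E -> F) (x v : E) (t : R) :
  differentiable f (x + t *: v) ->
  is_derive t 1 (fun t : R => f (x + t *: v)) (D f (x + t *: v) v).
Proof.
move=> df; have [dl lE] := differentiable_line x v t.
pose l (t : R) := x + t *: v.
have dfl : differentiable (f \o l) t by exact: differentiable_comp.
apply: DeriveDef; first exact/derivable1_diffP.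
rewrite [LHS](@deriveE _ _ _ (f \o l))// (diff_comp dl df) /= lE DE//.
by rewrite scale1r.
Qed.

Lemma increment_split (A1 A0 C : clin E R) (B : clin E (clin E R)) (u v : E) (s t : R) :
  A1 v - A0 v - s * B u v =
  (A1 - C - B (s *: u + t *: v)) v - (A0 - C - B (0 *: u + t *: v)) v.
Proof.
rewrite scale0r add0r !clin_mapD clin_mapZ.
move: (B (t *: v)) (B u) => b b'; rewrite !clinD !clinN !clinD clinZ.
rewrite -[s *: b' v]/(s * b' v).
move: (A1 v) (A0 v) (C v) (b v) (b' v) => /= x1 x0 y z z'.
ring.
Qed.

(** The mean value theorem for [t |-> f (x + s u + t v) - f (x + t v)] on
    [[0, s]] gives the second difference as [s] times the difference of [D f] at two
    points near [x], evaluated at [v]. Expanding [D f] to first order at [x]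
    leaves [s D (D f) x u v] up to an error of order [e' s]. *)
Lemma second_difference_approx (U : set E) (f : E -> R) (x u v : E) (e : R) :
  open U -> smooth_on U f -> U x -> 0 < e ->
  \forall s \near (0 : R)^'+, `|second_difference f x u v s - s ^+ 2 * D (D f) x u v|
    <= e * s ^+ 2.
Proof.
move=> oU fU Ux e0.
pose N := `|u| + `|v|; pose B := D (D f) x.
have N0 : 0 <= N by rewrite addr_ge0.
have dDf : differentiable (D f) x.
  exact: (smooth_on_differentiable (smooth_on_D fU)).
(* Each of the two expansions of D f contributes an error of at most
   s (e' (s N)) |v|, and |v| is at most N. *)
pose e' := e / (2 * (N * N + 1)).
have NN : 0 < N * N + 1 by rewrite ltr_wpDl// mulr_ge0.
have e'0 : 0 < e' by rewrite divr_gt0// mulr_gt0.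
have /has_diffP/(_ e' e'0) DfB : differentiable (D f) x /\ 'd (D f) x = B :> (E -> clin E R).
  by rewrite /B DE.
have : \forall h \near (0 : E), U (x + h) /\ `|D f (h + x) - D f x - B h| <= e' * `|h|.
  apply: filterI; last exact: DfB.
  exact: (nbhs0P U x).1 (open_near oU Ux).
move=> /nbhs_norm0P[r /= r0 rP].
near=> s.
have s0 : 0 < s by near: s; exact: nbhs_right_gt.
have sN : s * N < r.
  rewrite (@le_lt_trans _ _ (s * (N + 1)))//; first by rewrite ler_wpM2l ?ltW// ltrDl.
  by rewrite -ltr_pdivlMr ?ltr_wpDl//; near: s; apply: nbhs_right_lt; rewrite divr_gt0 ?ltr_wpDl.
have small a t : 0 <= a <= s -> 0 <= t <= s -> `|a *: u + t *: v| <= s * N.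
  move=> /andP[a0 a1] /andP[t0 t1]; rewrite (le_trans (ler_normD _ _))// mulrDr.
  by rewrite !normrZ !ger0_norm// lerD// ler_wpM2r.
have in_U a t : 0 <= a <= s -> 0 <= t <= s -> U (x + (a *: u + t *: v)).
  by move=> ha ht; apply: (rP _ _).1; exact: le_lt_trans (small _ _ ha ht) sN.
have rest a t : 0 <= a <= s -> 0 <= t <= s ->
    `|D f (x + (a *: u + t *: v)) - D f x - B (a *: u + t *: v)| <= e' * (s * N).
  move=> ha ht; rewrite [x + _]addrC; apply: le_trans ((rP _ _).2) _.
    exact: le_lt_trans (small _ _ ha ht) sN.
  by apply: ler_wpM2l; [exact: ltW|exact: small].
have ss : 0 <= s <= s by rewrite lexx ltW.
have zs : 0 <= (0 : R) <= s by rewrite lexx ltW.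
pose phi (t : R) := f (x + s *: u + t *: v) - f (x + t *: v).
pose dphi (t : R) := D f (x + s *: u + t *: v) v - D f (x + t *: v) v.
have der t : 0 <= t <= s -> is_derive t 1 phi (dphi t).
  move=> ht; have U1 := in_U s t ss ht; have U0 := in_U 0 t zs ht.
  rewrite addrA in U1; rewrite scale0r add0r in U0.
  by apply: (@is_deriveB _ _ _ (fun t : R => f (x + s *: u + t *: v))
                               (fun t : R => f (x + t *: v)));
    apply: is_derive_line; exact: smooth_on_differentiable fU _.
have [t tI phiE] : exists2 c, c \in `]0, s[ & phi s - phi 0 = dphi c * (s - 0).
  apply: MVT => //.
    by move=> t; rewrite in_itv/= => /andP[t0 ts]; apply: der; rewrite !ltW.
  apply: derivable_within_continuous => t; rewrite in_itv/= => /der dt.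
  exact: ex_derive.
have ht : 0 <= t <= s by move: tI; rewrite in_itv/= => /andP[? ?]; rewrite !ltW.
have -> : second_difference f x u v s = s * dphi t.
  have <- : phi s - phi 0 = s * dphi t by rewrite phiE subr0 mulrC.
  by rewrite /phi /second_difference scale0r !addr0; ring.
have -> : s * dphi t - s ^+ 2 * B u v =
    s * ((D f (x + (s *: u + t *: v)) - D f x - B (s *: u + t *: v)) v
       - (D f (x + (0 *: u + t *: v)) - D f x - B (0 *: u + t *: v)) v).
  rewrite expr2 -[s * s * _]mulrA -mulrBr; congr (s * _).
  by rewrite -increment_split scale0r add0r addrA.
rewrite normrM (gtr0_norm s0) expr2 mulrCA; apply: ler_wpM2l; first exact: ltW.
rewrite (le_trans (ler_normB _ _))//.
rewrite (@le_trans _ _ (e' * (s * N) * `|v| + e' * (s * N) * `|v|))//.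
  by rewrite lerD// (le_trans (clin_le _ _))// ler_wpM2r// rest.
rewrite -mulr2n -mulr_natl.
have -> : 2 * (e' * (s * N) * `|v|) = (2 * e' * (N * `|v|)) * s by lra.
apply: ler_wpM2r; first exact: ltW.
rewrite (@le_trans _ _ (2 * e' * (N * N + 1)))//.
  apply: ler_wpM2l; first by apply: mulr_ge0 => //; exact: ltW.
  by rewrite (@le_trans _ _ (N * N))// ?lerDl// ler_wpM2l// lerDr.
by rewrite [2 * e']mulrC -mulrA divfK// mulf_neq0// gt_eqF.
Unshelve. all: by end_near. Qed.

(** The second derivative of a smooth real function is symmetric: both its
    values on [(u, v)] and on [(v, u)] are the limit of the same, symmetric,
    second difference quotient. *)
Lemma D2_sym (U : set E) (f : E -> R) (x u v : E) :
  open U -> smooth_on U f -> U x -> D (D f) x u v = D (D f) x v u.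
Proof.
move=> oU fU Ux; apply/eqP; rewrite -subr_eq0 -normr_le0; apply/ler_addgt0Pr => e e0.
rewrite add0r.
have e2 : 0 < e / 2 by rewrite divr_gt0.
have [s [s0 [H1 H2]]] : exists s : R, 0 < s /\
    `|second_difference f x u v s - s ^+ 2 * D (D f) x u v| <= e / 2 * s ^+ 2 /\
    `|second_difference f x v u s - s ^+ 2 * D (D f) x v u| <= e / 2 * s ^+ 2.
  apply: (@filter_ex _ (0 : R)^'+).
  apply: filterI; first exact: nbhs_right_gt.
  by apply: filterI; exact: second_difference_approx oU fU Ux e2.
rewrite second_differenceC in H1.
have s2 : 0 < s ^+ 2 by rewrite exprn_gt0.
rewrite -(ler_pM2l s2) -{1}(gtr0_norm s2) -normrM mulrBr.
set a := second_difference f x v u s in H1 H2.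
have -> : s ^+ 2 * D (D f) x u v - s ^+ 2 * D (D f) x v u =
  (a - s ^+ 2 * D (D f) x v u) - (a - s ^+ 2 * D (D f) x u v) by lra.
rewrite (le_trans (ler_normB _ _))// (le_trans (lerD H2 H1))//.
by lra.
Qed.

End SecondDerivative.

(** * The Hahn-Banach theorem and reflexivity *)

Section HahnBanach.
Context {R : realType} (V : normedModType R).
Variable v0 : V.

(** The graphs of the linear functionals that are defined on a subspace
    containing [v0], are dominated by the norm and take the value [`|v0|] at
    [v0]; domination makes a linear relation single-valued. The empty set is
    included, as the union of the empty chain. *)
Definition dominated_graph (A : set (V * R)) : Prop :=
  [/\ forall a x y, A x -> A y -> A (a *: x.1 + y.1, a * x.2 + y.2),
      forall x, A x -> x.2 <= `|x.1| &
      forall x, A x -> A (v0, `|v0|)].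

Lemma dominated_graph_bigcup (F : set (set (V * R))) :
  F `<=` dominated_graph -> total_on F subset -> dominated_graph (\bigcup_(X in F) X).
Proof.
move=> FP totF; split.
- move=> a x y [X FX Xx] [Y FY Yy].
  have [XY|YX] := totF _ _ FX FY.
    by exists Y => //; have [+ _ _] := FP _ FY; apply=> //; exact: XY.
  by exists X => //; have [+ _ _] := FP _ FX; apply=> //; exact: YX.
- by move=> x [X FX Xx]; have [_ + _] := FP _ FX; apply.
- by move=> x [X FX Xx]; exists X => //; have [_ _] := FP _ FX; apply; exact: Xx.
Qed.

Lemma dominated_graph_line : dominated_graph (range (fun t : R => (t *: v0, t * `|v0|))).
Proof.
split.
- move=> a _ _ [s _ <-] [t _ <-] /=; exists (a * s + t) => //.
  by rewrite scalerDl scalerA mulrDl mulrA.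
- by move=> _ [t _ <-] /=; rewrite normrZ ler_wpM2r// ler_norm.
- by move=> _ _; exists 1 => //; rewrite scale1r mul1r.
Qed.

(** The one-step extension to [v]: a value [c] is admissible if and only if
    [z.2 - `|z.1 - v|] <= [c] <= [`|z.1 + v| - z.2] for all [z] in the graph. *)
Lemma dominated_graph_extend (A : set (V * R)) (v : V) : dominated_graph A ->
  A (v0, `|v0|) -> exists2 B, dominated_graph B & A `<=` B /\ exists c, B (v, c).
Proof.
move=> [lA dA pA] A0.
have Az : A (0, 0).
  have := lA (-1) _ _ A0 A0; rewrite /= scaleN1r addNr mulN1r addNr.
  by [].
have AZ a x : A x -> A (a *: x.1, a * x.2).
  by move=> /(lA a)/(_ Az); rewrite /= !addr0.
pose S := [set z.2 - `|z.1 - v| | z in A].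
have Sub z : A z -> ubound S (`|z.1 + v| - z.2).
  move=> Az1 _ [y Ay <-]; rewrite lerBrDr addrAC lerBlDr.
  have := dA _ (lA 1 _ _ Ay Az1); rewrite /= scale1r mul1r => /le_trans; apply.
  have -> : y.1 + z.1 = (z.1 + v) + (y.1 - v) by rewrite addrACA subrr addr0 addrC.
  exact: ler_normD.
have S0 : S !=set0 by exists (0 - `|0 - v|), (0, 0).
have hS : has_sup S by split => //; exists (`|0 + v| - 0); exact: Sub Az.
pose c := sup S.
have c_lo z : A z -> z.2 - `|z.1 - v| <= c.
  by move=> Az1; apply: ub_le_sup; [exact: hS.2|exists z].
have c_hi z : A z -> c <= `|z.1 + v| - z.2.
  by move=> Az1; apply: ge_sup => //; exact: Sub.
exists [set (z.1.1 + z.2 *: v, z.1.2 + z.2 * c) | z in [set z : (V * R) * R | A z.1]].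
  split.
  - move=> a _ _ [[x s] /= Ax <-] [[y t] /= Ay <-].
    exists ((a *: x.1 + y.1, a * x.2 + y.2), a * s + t) => /=; first exact: lA.
    congr pair; first by rewrite scalerDr scalerDl scalerA addrACA.
    by rewrite mulrDr mulrDl mulrA addrACA.
  - move=> _ [[x t] /= Ax <-] /=.
    have [t0|t0|->] := ltgtP t 0.
    (* Rescaled to t = -1, this is the lower bound on c; then the upper one. *)
    + have Ax' := AZ (- t)^-1 _ Ax.
      have nt : 0 < - t by rewrite oppr_gt0.
      have := c_lo _ Ax'; rewrite /= lerBlDr -lerBlDl -(ler_pM2l nt).
      rewrite mulrBr mulrA mulfV ?gt_eqF// mul1r mulNr opprK => /le_trans; apply.
      rewrite -{1}(gtr0_norm nt) -normrZ scalerBr scalerA mulfV ?gt_eqF// scale1r.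
      by rewrite scaleNr opprK.
    + have Ax' := AZ t^-1 _ Ax.
      have := c_hi _ Ax'; rewrite /= lerBrDr -(ler_pM2l t0).
      rewrite mulrDr mulrA mulfV ?gt_eqF// mul1r addrC => /le_trans; apply.
      rewrite -{1}(gtr0_norm t0) -normrZ scalerDr scalerA mulfV ?gt_eqF// scale1r.
      by [].
    + by rewrite mul0r scale0r !addr0; exact: dA.
  - by move=> _ _; exists ((v0, `|v0|), 0) => //=; rewrite scale0r mul0r !addr0.
split; last by exists c, ((0, 0), 1) => //=; rewrite scale1r mul1r !add0r.
by move=> [x r] Ax; exists ((x, r), 0) => //=; rewrite scale0r mul0r !addr0.
Qed.

(** Hahn-Banach: by Zorn's lemma there is a maximal dominated graph, and it
    is the graph of a functional defined everywhere, since any other one has a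
    proper extension. *)
Lemma norming_functional : exists f : dual V, f v0 = `|v0| /\ forall v, `|f v| <= `|v|.
Proof.
have [A [PA maxA]] := Zorn_bigcup dominated_graph_bigcup.
have [lA dA pA] := PA.
have A0 : A (v0, `|v0|).
  have [//|nA] := pselect (A (v0, `|v0|)); exfalso.
  apply: (maxA (range (fun t : R => (t *: v0, t * `|v0|)))); last exact: dominated_graph_line.
  split; first by move=> x /pA.
  move=> /(_ (v0, `|v0|)) h; apply/nA/h; exists 1 => //.
  by rewrite scale1r mul1r.
have total v : exists r, A (v, r).
  have [//|nv] := pselect (exists r, A (v, r)); exfalso.
  have [B PB [AB [c Bc]]] := dominated_graph_extend v PA A0.
  apply: (maxA B) => //; split=> // BA; apply: nv; exists c; exact: BA.
pose f v := projT1 (cid (total v)).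
have fA v : A (v, f v) by rewrite /f; case: cid.
have uniq v r s : A (v, r) -> A (v, s) -> r <= s.
  move=> Ar As; have := dA _ (lA (-1) _ _ As Ar).
  by rewrite /= scaleN1r addNr normr0 mulN1r addrC subr_le0.
have fE v r : A (v, r) -> f v = r.
  by move=> Ar; apply/eqP; rewrite eq_le (uniq v (f v) r)// (uniq v r (f v)).
have fl : linear f by move=> a x y; apply: fE; exact: (lA a (x, f x) (y, f y)).
have fn v : `|f v| <= `|v|.
  rewrite ler_norml (dA _ (fA v)) andbT lerNl.
  have := dA _ (fA (- v)); rewrite /= normrN; apply: le_trans.
  have -> : f (- v) = - f v.
    apply: fE; have := lA (-1) _ _ (fA v) (lA (-1) _ _ (fA v) (fA v)).
    by rewrite /= !scaleN1r !mulN1r addNr addNr !addr0.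
  by [].
exists (mkclin f); rewrite (@mkclin_bounded _ _ _ _ 1)//.
  by split; [exact: fE|exact: fn].
by move=> x; rewrite mul1r.
Qed.

End HahnBanach.

Section Reflexivity.
Context {R : realType} (E : normedModType R).

Lemma dual_separates (x y : E) : (forall nu : dual E, nu x = nu y) -> x = y.
Proof.
move=> xy; apply/eqP; rewrite -subr_eq0 -normr_eq0.
have [f [<- _]] := norming_functional (x - y).
by rewrite clin_mapB xy subrr.
Qed.

(** The inverse of the canonical map into the bidual is bounded because that map
    is an isometry, by Hahn-Banach. *)
Lemma reflexive_inverse : reflexive_space E ->
  exists L : clin (dual (dual E)) E, forall phi (nu : dual E), nu (L phi) = phi nu.
Proof.
move=> hE; pose g phi := projT1 (cid (hE phi)).
have gE phi (nu : dual E) : nu (g phi) = phi nu by rewrite /g; case: cid => xi /= ->.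
exists (mkclin g) => phi nu; rewrite (@mkclin_bounded _ _ _ _ 1)//.
- move=> a x y; apply: dual_separates => mu.
  by rewrite gE clin_mapD clin_mapZ !gE clinD clinZ.
- move=> psi; rewrite mul1r; have [f [<- fn]] := norming_functional (g psi).
  rewrite gE (le_trans (ler_norm _))// (le_trans (clin_le _ _))//.
  rewrite ler_piMr//; apply: clin_norm_bound => // v; rewrite mul1r; exact: fn.
Qed.

End Reflexivity.

(** * Calculus on manifolds *)

Section ManifoldCalculus.
Context {R : realType}.

Lemma open_setX (E F : normedModType R) (U : set E) (V : set F) :
  open U -> open V -> open (U `*` V).
Proof.
move=> oU oV.
have -> : U `*` V = (@fst E F @^-1` U) `&` (@snd E F @^-1` V) by [].
by apply: openI; apply: open_comp => // x _; [exact: cvg_fst|exact: cvg_snd].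
Qed.

Lemma open_fst_preimage (E F : normedModType R) (U : set E) :
  open U -> open (@fst E F @^-1` U).
Proof. by move=> oU; apply: open_comp => // x _; exact: cvg_fst. Qed.

Lemma D_prod_map (E F K L : normedModType R) (f : E -> K) (g : F -> L) (x : E * F) v :
  differentiable f x.1 -> differentiable g x.2 ->
  differentiable (fun y => (f y.1, g y.2)) x /\
  D (fun y => (f y.1, g y.2)) x v = (D f x.1 v.1, D g x.2 v.2).
Proof.
move=> df dg.
have fstE : fst = cfst E F :> (_ -> _) by apply/funext => y; rewrite cfstE.
have sndE : snd = csnd E F :> (_ -> _) by apply/funext => y; rewrite csndE.
have d1 : differentiable (@fst E F) x by rewrite fstE; exact: differentiable_clin.
have d2 : differentiable (@snd E F) x by rewrite sndE; exact: differentiable_clin.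
have df1 : differentiable (f \o fst) x by exact: differentiable_comp.
have dg2 : differentiable (g \o snd) x by exact: differentiable_comp.
split; first exact: (differentiable_pair df1 dg2).
rewrite [LHS](@D_pair _ _ _ _ (f \o fst) (g \o snd) _ _ df1 dg2).
rewrite (D_comp d1 df) (D_comp d2 dg) !ccompE.
have -> : D (@fst E F) x = cfst E F by rewrite fstE D_clin.
have -> : D (@snd E F) x = csnd E F by rewrite sndE D_clin.
by rewrite cfstE csndE.
Qed.

Section TwoManifolds.
Context (T T' : Type) (E E' : normedModType R).
Variables (A : atlas T E) (A' : atlas T' E').

Definition chart_rep (p : T) (p' : T') (f : T -> T') : E -> E' :=
  chart A' p' \o f \o unchart A p.

(** The tangent map of [f] at [q], read in the charts of arbitrary indices
    around [q] and [f q]. Tangent maps, differentials of functions and changes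
    of representative are all of this form, so that the chain rule below covers
    every computation with tangent vectors. *)
Definition mder (p : T) (p' : T') (f : T -> T') (q : T) : clin E E' :=
  D (chart_rep p p' f) (chart A p q).

Lemma tmapE (f : T -> T') p : tmap A A' f p = mder p (f p) f p.
Proof. by rewrite /mder D_def. Qed.

End TwoManifolds.

Lemma dfunE (T : Type) (E : normedModType R) (A : atlas T E) (f : T -> R) p :
  dfun A f p = mder A (vec_atlas R) p (f p) f p.
Proof. exact: tmapE. Qed.

Lemma tcoordE (T : Type) (E : normedModType R) (A : atlas T E) q p r :
  tcoord A q p r = mder A A q p id r.
Proof. by rewrite /mder D_def. Qed.

Section OneManifold.
Context (T : Type) (E : normedModType R) (A : atlas T E).
Hypothesis hA : is_manifold A.

Lemma chart_inj p q r : dom A p q -> dom A p r -> chart A p q = chart A p r -> q = r.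
Proof. by move=> pq pr e; rewrite -(chartK hA pq) e chartK. Qed.

Lemma unchartK p x : (chart A p @` dom A p) x -> chart A p (unchart A p x) = x.
Proof. by move=> [q pq <-]; rewrite chartK. Qed.

Lemma unchart_dom p x : (chart A p @` dom A p) x -> dom A p (unchart A p x).
Proof. by move=> [q pq <-]; rewrite chartK. Qed.

Lemma chart_img p q : dom A p q -> (chart A p @` dom A p) (chart A p q).
Proof. by move=> pq; exists q. Qed.

End OneManifold.

Lemma vec_manifold (E : normedModType R) : is_manifold (vec_atlas E).
Proof.
split=> //.
- by move=> p /=; rewrite image_id; exact: openT.
- by move=> p q /=; rewrite image_id setIT; exact: openT.
- by move=> p q; exact: smooth_on_id.
Qed.

Section ProductManifold.
Context (T T' : Type) (E E' : normedModType R) (A : atlas T E) (A' : atlas T' E').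
Hypotheses (hA : is_manifold A) (hA' : is_manifold A').

Lemma prod_image p q :
  chart (prod_atlas A A') p @` (dom (prod_atlas A A') p `&` dom (prod_atlas A A') q) =
  (chart A p.1 @` (dom A p.1 `&` dom A q.1)) `*`
  (chart A' p.2 @` (dom A' p.2 `&` dom A' q.2)).
Proof.
apply/seteqP; split=> [_ [r [[p1 p2] [q1 q2]] <-]|[x y] [/= [r [? ?] <-] [s [? ?] <-]]].
  by split; [exists r.1|exists r.2].
by exists (r, s).
Qed.

Lemma prod_manifold : is_manifold (prod_atlas A A').
Proof.
have oo p q : open (chart (prod_atlas A A') p @`
    (dom (prod_atlas A A') p `&` dom (prod_atlas A A') q)).
  by rewrite prod_image; apply: open_setX; exact: open_overlap.
split.
- by move=> p; split; exact: dom_self.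
- by move=> p q [p1 p2]; rewrite /= !chartK// -surjective_pairing.
- by move=> p; have := oo p p; rewrite setIid.
- exact: oo.
- move=> p q; have := oo p q; rewrite prod_image => o.
  apply: smooth_on_pair => //.
    apply: (@smooth_on_comp _ _ _ _ _ (chart A p.1 @` (dom A p.1 `&` dom A q.1)) fst
      (chart A q.1 \o unchart A p.1)) => //; first by move=> x [].
      exact: smooth_on_fst.
    exact: smooth_transition.
  apply: (@smooth_on_comp _ _ _ _ _ (chart A' p.2 @` (dom A' p.2 `&` dom A' q.2)) snd
    (chart A' q.2 \o unchart A' p.2)) => //; first by move=> x [].
    exact: smooth_on_snd.
  exact: smooth_transition.
Qed.

Lemma transition_differentiable p q r : dom A p r -> dom A q r ->
  differentiable (chart A q \o unchart A p) (chart A p r).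
Proof.
move=> pr qr; apply: smooth_on_differentiable; first exact: (smooth_transition hA p q).
by exists r.
Qed.

End ProductManifold.

Lemma tcoord_prod (T T' : Type) (E E' : normedModType R) (A : atlas T E) (A' : atlas T' E')
  (hA : is_manifold A) (hA' : is_manifold A') (q p r : T * T') v :
  dom (prod_atlas A A') q r -> dom (prod_atlas A A') p r ->
  tcoord (prod_atlas A A') q p r v =
  (tcoord A q.1 p.1 r.1 v.1, tcoord A' q.2 p.2 r.2 v.2).
Proof.
move=> [q1 q2] [p1 p2]; rewrite !tcoordE /mder.
have d1 := transition_differentiable hA q1 p1.
have d2 := transition_differentiable hA' q2 p2.
by have [_ ->] := @D_prod_map _ _ _ _ (chart A p.1 \o unchart A q.1)
  (chart A' p.2 \o unchart A' q.2) (chart A q.1 r.1, chart A' q.2 r.2) v d1 d2.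
Qed.

Lemma tcoord_vec (E : normedModType R) (q p r : E) : tcoord (vec_atlas E) q p r = idclin E.
Proof.
rewrite tcoordE /mder /chart_rep /=.
have -> : id \o id \o id = idclin E :> (E -> E) by apply/funext => x; rewrite idclinE.
by rewrite D_clin.
Qed.

Section SmoothMaps.
Context (T T' : Type) (E E' : normedModType R).
Variables (A : atlas T E) (A' : atlas T' E').
Hypotheses (hA : is_manifold A) (hA' : is_manifold A').

(** Smoothness was required in centred charts only; by the smoothness of the
    transition maps it holds in all charts. *)
Lemma smooth_charts (f : T -> T') p q p' : smooth A A' f ->
  dom A p q -> dom A' p' (f q) ->
  exists U : set E, [/\ open U, U (chart A p q), U `<=` chart A p @` dom A p,
    forall x, U x -> dom A' p' (f (unchart A p x)) &
    smooth_on U (chart_rep A A' p p' f)].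
Proof.
move=> sf pq pfq; have [U0 [oU0 U0q U0q' U0f sU0]] := sf q.
pose tau := chart A q \o unchart A p.
pose V := chart A p @` (dom A p `&` dom A q).
have oV : open V := open_overlap hA p q.
have sV : smooth_on V tau := smooth_transition hA p q.
pose U1 := V `&` tau @^-1` U0.
have oU1 : open U1 by exact: smooth_on_open_preimage sV.
have unE x : V x -> unchart A q (tau x) = unchart A p x.
  by move=> [r [pr qr] <-]; rewrite /tau /= (chartK hA pr) chartK.
pose g := chart_rep A A' p (f q) f.
have sg : smooth_on U1 g.
  have : smooth_on U1 (fun x => (chart A' (f q) \o f \o unchart A q) (tau x)).
    apply: (smooth_on_comp oU1 _ _ sU0) => [x []//|].
    by apply: smooth_on_sub sV => x [].
  by apply: smooth_on_eq => // x [Vx _] /=; rewrite unE.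
(* The part of the chart of index f q that is covered by the chart p'. *)
pose W := chart A' (f q) @` (dom A' (f q) `&` dom A' p').
have oW : open W := open_overlap hA' (f q) p'.
have fdom x : U1 x -> dom A' (f q) (f (unchart A p x)).
  by move=> [Vx U0x]; rewrite -unE//; exact: U0f.
have fdom' x : U1 x -> W (g x) -> dom A' p' (f (unchart A p x)).
  move=> U1x [r [qr pr] e]; suff <- : r = f (unchart A p x) by [].
  exact: (chart_inj hA' qr (fdom x U1x)).
exists (U1 `&` g @^-1` W); split.
- exact: smooth_on_open_preimage sg.
- have qq := dom_self hA q.
  split; first split.
  + by exists q.
  + by rewrite /tau /= (chartK hA pq).
  + by exists (f q); rewrite /g /chart_rep /= ?(chartK hA pq)//; split => //; exact: dom_self.
- by move=> x [[[r [pr _] <-] _] _]; exists r.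
- by move=> x [U1x Wx]; exact: fdom'.
- have : smooth_on (U1 `&` g @^-1` W) (fun x => (chart A' p' \o unchart A' (f q)) (g x)).
    apply: (@smooth_on_comp _ _ _ _ _ W).
    + exact: smooth_on_open_preimage sg.
    + by move=> x [].
    + by apply: smooth_on_sub sg => x [].
    + exact: smooth_transition.
  apply: smooth_on_eq; first exact: smooth_on_open_preimage sg.
  move=> x [U1x _]; rewrite /= /g /chart_rep /= chartK//; exact: fdom.
Qed.

End SmoothMaps.

Lemma smooth_id (T : Type) (E : normedModType R) (A : atlas T E) :
  is_manifold A -> smooth A A id.
Proof.
move=> hA p; exists (chart A p @` dom A p); split => //.
- exact: open_chart.
- exact/chart_img/dom_self.
- by move=> x [q pq <-]; rewrite chartK.
- by have := smooth_transition hA p p; rewrite setIid.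
Qed.

Lemma smooth_comp (T T' T'' : Type) (E E' E'' : normedModType R)
  (A : atlas T E) (A' : atlas T' E') (A'' : atlas T'' E'')
  (hA : is_manifold A) (hA' : is_manifold A') (hA'' : is_manifold A'') f g :
  smooth A A' f -> smooth A' A'' g -> smooth A A'' (g \o f).
Proof.
move=> sf sg p.
have [U [oU Up Up' Uf sU]] := sf p; have [V [oV Vp Vp' Vg sV]] := sg (f p).
pose F := chart A' (f p) \o f \o unchart A p.
have oW : open (U `&` F @^-1` V) by exact: smooth_on_open_preimage.
have FK x : U x -> unchart A' (f p) (F x) = f (unchart A p x).
  by move=> Ux; rewrite /F /= chartK//; exact: Uf.
exists (U `&` F @^-1` V); split => //.
- by split=> //; rewrite /F /= (chartK hA (dom_self hA p)).
- by move=> x [Ux _]; exact: Up'.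
- by move=> x [Ux Vx] /=; rewrite -FK//; exact: Vg.
- have : smooth_on (U `&` F @^-1` V)
      (fun x => (chart A'' (g (f p)) \o g \o unchart A' (f p)) (F x)).
    apply: (smooth_on_comp oW _ _ sV) => [x []//|].
    by apply: smooth_on_sub sU => x [].
  by apply: smooth_on_eq => // x [Ux _] /=; rewrite FK.
Qed.

(** The chain rule. The left hand side does not depend on the intermediate chart,
    which can be chosen at will. *)
Lemma mder_comp (T T' T'' : Type) (E E' E'' : normedModType R)
  (A : atlas T E) (A' : atlas T' E') (A'' : atlas T'' E'')
  (hA : is_manifold A) (hA' : is_manifold A') (hA'' : is_manifold A'') f g p p' p'' q :
  smooth A A' f -> smooth A' A'' g ->
  dom A p q -> dom A' p' (f q) -> dom A'' p'' (g (f q)) ->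
  mder A A'' p p'' (g \o f) q = ccomp (mder A' A'' p' p'' g (f q)) (mder A A' p p' f q).
Proof.
move=> sf sg pq pfq pgq.
have [U [oU Uq _ Uf sU]] := smooth_charts hA hA' sf pq pfq.
have [V [oV Vq _ _ sV]] := smooth_charts hA' hA'' sg pfq pgq.
have df := smooth_on_differentiable sU Uq.
have fq : chart_rep A A' p p' f (chart A p q) = chart A' p' (f q).
  by rewrite /chart_rep /= (chartK hA pq).
have dg : differentiable (chart_rep A' A'' p' p'' g) (chart_rep A A' p p' f (chart A p q)).
  by rewrite fq; exact: smooth_on_differentiable sV Vq.
have DE := D_comp df dg; rewrite fq in DE.
rewrite /mder -DE; apply: D_near.
  apply: filterS (open_near oU Uq) => x Ux.
  by rewrite /chart_rep /= (chartK hA' (Uf x Ux)).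
have [W [oW Wq _ _ sW]] := smooth_charts hA hA'' (smooth_comp hA hA' hA'' sf sg) pq pgq.
exact: smooth_on_differentiable sW Wq.
Qed.

Lemma mder_id (T : Type) (E : normedModType R) (A : atlas T E) (hA : is_manifold A) p q :
  dom A p q -> mder A A p p id q = idclin E.
Proof.
move=> pq.
have d : differentiable (chart_rep A A p p id) (chart A p q).
  exact: (transition_differentiable hA pq pq).
rewrite /mder (@D_near _ _ _ _ (idclin E) _ _ d) ?D_clin//.
have := open_near (open_chart hA p) (chart_img pq); apply: filterS => x xp.
by rewrite idclinE /chart_rep /= unchartK.
Qed.

Lemma tcoordK (T : Type) (E : normedModType R) (A : atlas T E) (hA : is_manifold A) p q r :
  dom A p r -> dom A q r -> ccomp (tcoord A q p r) (tcoord A p q r) = idclin E.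
Proof.
move=> pr qr; rewrite !tcoordE -(@mder_comp _ _ _ _ _ _ _ _ _ hA hA hA id id)//.
- exact: mder_id.
- exact: smooth_id.
- exact: smooth_id.
Qed.

End ManifoldCalculus.

(** * Partial derivatives and curves *)

Section PartialDerivatives.
Context {R : realType}.
Implicit Types E F K : normedModType R.

Definition cpair E F K (f : clin E F) (g : clin E K) : clin E (F * K)%type :=
  ccomp (cinl F K) f + ccomp (cinr F K) g.

Lemma cpairE E F K (f : clin E F) (g : clin E K) x : cpair f g x = (f x, g x).
Proof. by rewrite /cpair clinD !ccompE cinlE cinrE [RHS]pairD. Qed.

#[global] Opaque cpair.

Lemma D_id E (x : E) : differentiable (@id E) x /\ D (@id E) x = idclin E.
Proof.
have -> : @id E = idclin E :> (E -> E) by apply/funext => y; rewrite idclinE.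
by split; [exact: differentiable_clin|exact: D_clin].
Qed.

Lemma D_comp_clin E F K (f : F -> K) (L : clin E F) x v : differentiable f (L x) ->
  differentiable (fun y => f (L y)) x /\ D (fun y => f (L y)) x v = D f (L x) (L v).
Proof.
move=> df; have dL := differentiable_clin L x; split.
  exact: (@differentiable_comp _ _ _ _ L f).
have -> : D (fun y => f (L y)) x = ccomp (D f (L x)) (D L x) := D_comp dL df.
by rewrite ccompE D_clin.
Qed.

Lemma D_opp E F (f : E -> F) x : differentiable f x ->
  differentiable (fun y => - f y) x /\ D (fun y => - f y) x = - D f x.
Proof.
move=> df; pose N : clin F F := - idclin F.
have NE y : N y = - y by rewrite /N clinN idclinE.
have -> : (fun y => - f y) = N \o f by apply/funext => y; rewrite -NE.
have dN := differentiable_clin N (f x).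
split; first exact: differentiable_comp.
rewrite (D_comp df dN) (D_clin N); apply: clin_ext => v.
by rewrite ccompE NE clinN.
Qed.

Lemma D_partial1 E F K (f : E * F -> K) a b v : differentiable f (a, b) ->
  D (fun x => f (x, b)) a v = D f (a, b) (v, 0).
Proof.
move=> df.
have d1 : differentiable (fun x : E => (x, b)) a.
  by apply: differentiable_pair; [exact: (D_id _).1|exact: differentiable_cst].
have -> : D (fun x => f (x, b)) a = ccomp (D f (a, b)) (D (fun x => (x, b)) a) := D_comp d1 df.
rewrite ccompE (@D_pair _ _ _ _ id (cst b)); [|exact: (D_id _).1|exact: differentiable_cst].
by rewrite (D_id _).2 idclinE D_cst.
Qed.

Lemma D_partial2 E F K (f : E * F -> K) a b v : differentiable f (a, b) ->
  D (fun x => f (a, x)) b v = D f (a, b) (0, v).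
Proof.
move=> df.
have d1 : differentiable (fun x : F => (a, x)) b.
  by apply: differentiable_pair; [exact: differentiable_cst|exact: (D_id _).1].
have -> : D (fun x => f (a, x)) b = ccomp (D f (a, b)) (D (fun x => (a, x)) b) := D_comp d1 df.
rewrite ccompE (@D_pair _ _ _ _ (cst a) id); [|exact: differentiable_cst|exact: (D_id _).1].
by rewrite (D_id _).2 idclinE D_cst.
Qed.

Lemma D_apply E F K (f : E -> clin F K) (w : F) x v : differentiable f x ->
  differentiable (fun y => f y w) x /\ D (fun y => f y w) x v = D f x v w.
Proof.
move=> df; have [d ->] := differentiable_eval df (@differentiable_cst _ _ _ w x).
by split=> //; rewrite D_cst clin_map0 add0r.
Qed.

End PartialDerivatives.

Section Curves.
Context {R : realType} (E : normedModType R).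

Lemma line_near (U : set E) (x v : E) : open U -> U x ->
  \forall t \near (0 : R), U (x + t *: v).
Proof.
move=> oU Ux.
have : \forall h \near (0 : E), U (x + h) by apply: (nbhs0P U x).1; exact: open_near.
by move/(near0Z v).
Qed.

Lemma line0 (x v : E) : x + (0 : R) *: v = x.
Proof. by rewrite scale0r addr0. Qed.

Lemma is_derive_curve (K : normedModType R) (c : R -> K) (F : E -> K) x v :
  differentiable F x -> (\forall t \near (0 : R), c t = F (x + t *: v)) ->
  is_derive (0 : R) (1 : R) c (D F x v).
Proof.
move=> dF cF.
have dl : is_derive (0 : R) (1 : R) (fun t : R => F (x + t *: v)) (D F x v).
  by have := @is_derive_line _ _ _ F x v 0; rewrite line0; apply.
refine (near_eq_is_derive _ dl).
by apply: filterS cF => t ->.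
Qed.

End Curves.

(** * Tangent vectors in cotangent bundles *)

Section Tangents.
Context {R : realType} (T : Type) (E : normedModType R) (A : atlas T E).
Hypothesis hA : is_manifold A.

(** The graph of [d f] is in cotangent charts the graph of the derivative of the
    local representative of [f]. *)
Lemma tangent_image_dfun (f : T -> R) p v : smooth A (vec_atlas R) f ->
  tangent (cotangent_atlas A) (image_dfun A f) (p, dfun A f p)
    (v, D (D (f \o unchart A p)) (chart A p p) v).
Proof.
move=> sf; pose x0 := chart A p p; pose e := f \o unchart A p.
have [U [oU Ux UI _ sU]] := smooth_charts hA (vec_manifold R) sf (dom_self hA p)
  (I : dom (vec_atlas R) (f p) (f p)).
pose q (t : R) := unchart A p (x0 + t *: v).
have q0 : q 0 = p by rewrite /q line0 /x0 (chartK hA (dom_self hA p)).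
have pq t : U (x0 + t *: v) -> dom A p (q t) by move=> /UI; exact: unchart_dom.
exists (fun t => (q t, dfun A f (q t))); split.
- by rewrite q0.
- apply: filterS (line_near v oU Ux) => t Ut; split => //.
  by split => //; exact: pq.
- pose F y := (y, D e y).
  have dDe : differentiable (D e) x0 by exact: smooth_on_differentiable (smooth_on_D sU) Ux.
  have dF : differentiable F x0.
    by apply: differentiable_pair; [exact: (D_id _).1|].
  have FE : D F x0 v = (v, D (D e) x0 v).
    rewrite (@D_pair _ _ _ _ id (D e) _ _ (D_id _).1 dDe).
    by rewrite (D_id _).2 idclinE.
  rewrite -FE; apply: (@is_derive_curve _ _ (E * dual E)%type _ F x0 v dF).
  apply: filterS (line_near v oU Ux) => t Ut; rewrite /F /=.
  rewrite {1}/q (unchartK hA (UI _ Ut)); congr pair.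
  have pqt := pq t Ut.
  have -> : mkclin (dfun A f (q t) \o tcoord A p (q t) (q t)) =
    ccomp (dfun A f (q t)) (tcoord A p (q t) (q t)) by [].
  rewrite dfunE tcoordE -(mder_comp (p'' := f (q t)) hA hA (vec_manifold R)
    (smooth_id hA) sf pqt (dom_self hA _) I).
  by rewrite /mder /q (unchartK hA (UI _ Ut)).
Qed.

(** The coordinate line through [(p, lambda)] with direction [(v, eta)]: if it stays
    in [S], its velocity is tangent to [S]. *)
Lemma tangent_cotangent_line (S : set (T * dual E)) p (lambda eta : dual E) v (U : set E) :
  open U -> U (chart A p p) -> U `<=` chart A p @` dom A p ->
  (forall x (t : R), U x -> let q := unchart A p x in
    S (q, ccomp (lambda + t *: eta) (tcoord A q p q))) ->
  tangent (cotangent_atlas A) S (p, lambda) (v, eta).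
Proof.
move=> oU Ux UI US; pose x0 := chart A p p.
pose q (t : R) := unchart A p (x0 + t *: v).
have q0 : q 0 = p by rewrite /q line0 /x0 (chartK hA (dom_self hA p)).
exists (fun t => (q t, ccomp (lambda + t *: eta) (tcoord A (q t) p (q t)))); split.
- rewrite q0 scale0r addr0 tcoordE mder_id//; last exact: dom_self.
  by rewrite ccompf1.
- apply: filterS (line_near v oU Ux) => t Ut; split; first exact: US.
  by split => //; exact/unchart_dom/UI.
- have -> : (v, eta) = D (idclin (E * dual E)%type) (x0, lambda) (v, eta).
    by rewrite D_clin idclinE.
  apply: (@is_derive_curve _ _ (E * dual E)%type); first exact: differentiable_clin.
  apply: filterS (line_near v oU Ux) => t Ut; rewrite idclinE /=.
  have pqt : dom A p (q t) by exact/unchart_dom/UI.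
  rewrite {1}/q (unchartK hA (UI _ Ut)); congr pair.
  have -> : mkclin (ccomp (lambda + t *: eta) (tcoord A (q t) p (q t)) \o tcoord A p (q t) (q t)) =
    ccomp (ccomp (lambda + t *: eta) (tcoord A (q t) p (q t))) (tcoord A p (q t) (q t)) by [].
  by rewrite -ccompA (tcoordK hA)// ?ccompf1//; exact: dom_self.
Qed.

End Tangents.

(** * The Hamiltonian and the energy in charts *)

Section Hamiltonian.
Context {R : realType} (E : normedModType R) (G : groupType) (A : atlas G E).
Hypothesis hA : is_manifold A.
Variable H : G * dual E -> R.
Hypothesis hH : smooth (prod_atlas A (vec_atlas (dual E))) (vec_atlas R) H.

Definition H_rep (g0 : G) (x : E * dual E) : R := H (unchart A g0 x.1, x.2).

Lemma cotG_manifold : is_manifold (prod_atlas A (vec_atlas (dual E))).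
Proof. exact: prod_manifold hA (vec_manifold _). Qed.

Lemma H_rep_smooth g0 g (mu : dual E) : dom A g0 g ->
  exists U : set (E * dual E), [/\ open U, U (chart A g0 g, mu),
    forall x, U x -> (chart A g0 @` dom A g0) x.1 & smooth_on U (H_rep g0)].
Proof.
move=> gg; have [] := @smooth_charts _ _ _ _ _ _ _ cotG_manifold (vec_manifold R) H
  (g0, mu) (g, mu) (H (g, mu)) hH (conj gg I) I.
move=> U [oU Ux UI _ sU]; exists U; split => //.
by move=> x /UI[[r nu] [/= gr _] <-]; exists r.
Qed.

Lemma H_rep_differentiable g0 g (mu : dual E) : dom A g0 g ->
  differentiable (H_rep g0) (chart A g0 g, mu).
Proof.
by move=> /(H_rep_smooth mu)[U [_ Ux _ sU]]; exact: smooth_on_differentiable sU Ux.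
Qed.

Lemma dH_dgE g0 g mu v : dom A g0 g ->
  mder A (vec_atlas R) g0 (H (g, mu)) (fun h => H (h, mu)) g v =
  D (H_rep g0) (chart A g0 g, mu) (v, 0).
Proof.
by move=> gg; rewrite -(D_partial1 _ (H_rep_differentiable mu gg)).
Qed.

Lemma dH_dmuE g0 g mu nu : dom A g0 g ->
  dfun (vec_atlas (dual E)) (fun mu' => H (g, mu')) mu nu =
  D (H_rep g0) (chart A g0 g, mu) (0, nu).
Proof.
move=> gg; rewrite -(D_partial2 _ (H_rep_differentiable mu gg)) dfunE /mder.
have -> : (fun x => H_rep g0 (chart A g0 g, x)) = chart_rep (vec_atlas (dual E))
  (vec_atlas R) mu (H (g, mu)) (fun mu' => H (g, mu')) => //.
by apply/funext => x; rewrite /H_rep /= (chartK hA gg).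
Qed.

(** Reflexivity provides the vector of [E] that represents the partial differential
    of [H] in the momentum. *)
Lemma dH_dmu_spec (hE : reflexive_space E) g0 g mu (nu : dual E) : dom A g0 g ->
  nu (dH_dmu H g mu) = D (H_rep g0) (chart A g0 g, mu) (0, nu).
Proof.
move=> gg; rewrite -(dH_dmuE _ _ gg) /dH_dmu.
case: xgetP => [xi _ ->//|].
have [xi xiE] := hE (dfun (vec_atlas (dual E)) (fun mu' => H (g, mu')) mu).
by move=> /(_ xi)/=; case; exact: xiE.
Qed.

Definition projH : clin (E * (E * dual E))%type (E * dual E)%type :=
  cpair (cfst _ _) (ccomp (csnd _ _) (csnd _ _)).

Lemma projHE x : projH x = (x.1, x.2.2).
Proof. by rewrite /projH cpairE ccompE cfstE !csndE. Qed.

Definition energy_rep (g0 : G) (x : E * (E * dual E)) : R :=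
  x.2.2 x.2.1 - H_rep g0 (projH x).

Lemma energy_repE g0 : energy_rep g0 = morse_energy H \o unchart (PG_atlas A) (g0, (0, 0)).
Proof. by apply/funext => -[y [xi mu]]; rewrite /energy_rep projHE. Qed.

Definition xi_part : clin (E * (E * dual E))%type E := ccomp (cfst _ _) (csnd _ _).
Definition mu_part : clin (E * (E * dual E))%type (dual E) := ccomp (csnd _ _) (csnd _ _).
Lemma xi_partE x : xi_part x = x.2.1. Proof. by rewrite /xi_part ccompE csndE cfstE. Qed.
Lemma mu_partE x : mu_part x = x.2.2. Proof. by rewrite /mu_part ccompE !csndE. Qed.

Lemma energy_rep_smooth g0 (U : set (E * dual E)) : open U -> smooth_on U (H_rep g0) ->
  smooth_on (projH @^-1` U) (energy_rep g0).
Proof.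
move=> oU sU.
have oV : open (projH @^-1` U) by apply: open_comp => // x _; exact: clin_continuous.
have -> : energy_rep g0 = fun x => mu_part x (xi_part x) + - H_rep g0 (projH x).
  by apply/funext => x; rewrite xi_partE mu_partE.
apply: smooth_on_add => //.
  by apply: smooth_on_eval => //; exact: smooth_on_clin.
apply: smooth_on_opp => //.
by apply: smooth_on_comp sU => //; exact: smooth_on_clin.
Qed.

Lemma D_energy_rep g0 (x w : E * (E * dual E)) : differentiable (H_rep g0) (projH x) ->
  D (energy_rep g0) x w =
    x.2.2 w.2.1 + w.2.2 x.2.1 - D (H_rep g0) (projH x) (w.1, w.2.2).
Proof.
move=> dh.
have [d1 D1] := differentiable_eval (differentiable_clin mu_part x) (differentiable_clin xi_part x).
have [d2 D2] := D_comp_clin w dh; rewrite (projHE w) in D2.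
have [d3 D3] := D_opp d2.
rewrite (D_clin mu_part) (D_clin xi_part) !xi_partE !mu_partE in D1.
have -> : energy_rep g0 = (fun y => mu_part y (xi_part y)) \+ (fun y => - H_rep g0 (projH y)).
  by apply/funext => y; rewrite /= xi_partE mu_partE.
have -> : D ((fun y => mu_part y (xi_part y)) \+ (fun y => - H_rep g0 (projH y))) x =
  D (fun y => mu_part y (xi_part y)) x + D (fun y => - H_rep g0 (projH y)) x := D_add d1 d3.
rewrite clinD; congr (_ + _); first by rewrite -(xi_partE w) -(mu_partE w); exact: D1.
rewrite D3 clinN; congr (- _); exact: D2.
Qed.

Lemma PG_manifold : is_manifold (PG_atlas A).
Proof. exact: prod_manifold hA (prod_manifold (vec_manifold _) (vec_manifold _)). Qed.

Lemma energy_smooth : smooth (PG_atlas A) (vec_atlas R) (morse_energy H).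
Proof.
move=> [g [xi mu]]; have [U [oU Ux UI sU]] := H_rep_smooth mu (dom_self hA g).
exists (projH @^-1` U); split => //.
- by apply: open_comp => // x _; exact: clin_continuous.
- by rewrite /preimage/mkset projHE.
- move=> [y [a b]] /UI; rewrite projHE /= => -[h gh <-].
  by exists (h, (a, b)).
- have := energy_rep_smooth oU sU; rewrite energy_repE; exact.
Qed.

(** The projection of the Pontryagin bundle is the identity on the group factor,
    so its tangent map forgets the last component. *)
Lemma tmap_PG_proj p w : tmap (PG_atlas A) (TG_atlas A) PG_proj p w = (w.1, w.2.1).
Proof.
pose L := cpair (cfst E (E * dual E)%type) xi_part.
have LE x : L x = (x.1, x.2.1) by rewrite /L cpairE cfstE xi_partE.
have DL : D L (chart (PG_atlas A) p p) =
    D (chart_rep (PG_atlas A) (TG_atlas A) p (PG_proj p) PG_proj) (chart (PG_atlas A) p p).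
  apply: D_near; last exact: differentiable_clin.
  have := open_near (open_chart PG_manifold p) (chart_img (dom_self PG_manifold p)).
  apply: filterS => x [[g [xi mu]] [pg _] <-].
  by rewrite LE /chart_rep /= (chartK hA pg).
by rewrite tmapE /mder -DL D_clin LE.
Qed.

Lemma dfun_energy g xi mu w :
  dfun (PG_atlas A) (morse_energy H) (g, (xi, mu)) w =
  mu w.2.1 + w.2.2 xi - D (H_rep g) (chart A g g, mu) (w.1, w.2.2).
Proof.
have dh := H_rep_differentiable mu (dom_self hA g).
have := @D_energy_rep g (chart A g g, (xi, mu)) w; rewrite projHE => /(_ dh) <-.
by rewrite dfunE /mder energy_repE.
Qed.

End Hamiltonian.

(** * The Morse family and the set it generates *)

Section MorseFamily.
Context {R : realType} (E : normedModType R) (G : groupType) (A : atlas G E).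
Hypotheses (hA : is_manifold A) (hE : reflexive_space E).
Variable H : G * dual E -> R.
Hypothesis hH : smooth (prod_atlas A (vec_atlas (dual E))) (vec_atlas R) H.

(** The mixed second derivative of the energy in [(xi, mu)] is the duality
    pairing: [H] does not depend on [xi]. *)
Lemma energy_hessian g mu xi0 xi (c : dual E) :
  D (D (energy_rep A H g)) (chart A g g, (xi0, mu)) (0, (xi, 0)) (0, (0, c)) = c xi.
Proof.
have [U [oU Ux _ sU]] := H_rep_smooth hA hH mu (dom_self hA g).
set x0 := (chart A g g, (xi0, mu)); set V := (0, (xi, 0)); set W := (0, (0, c)).
have Ux0 : U (projH E x0) by rewrite projHE.
have oV : open (projH E @^-1` U) by apply: open_comp => // x _; exact: clin_continuous.
have se := energy_rep_smooth oU sU.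
have dDe : differentiable (D (energy_rep A H g)) x0.
  exact: smooth_on_differentiable (smooth_on_D se) Ux0.
have [dW <-] := D_apply W V dDe.
pose K m := D (H_rep A H g) m (0, c).
have dDh : differentiable (D (H_rep A H g)) (projH E x0).
  exact: smooth_on_differentiable (smooth_on_D sU) Ux0.
have [dK _] := D_apply (0, c) 0 dDh.
have [dKp DKp] := D_comp_clin V dK.
have [dN DN] := D_opp dKp.
pose l := ccomp c (xi_part E).
have dl := differentiable_clin l x0.
have WE y : U (projH E y) -> D (energy_rep A H g) y W = l y + - K (projH E y).
  move=> Uy; rewrite D_energy_rep; last exact: smooth_on_differentiable sU Uy.
  by rewrite /W /= clin_map0 add0r /l ccompE xi_partE.
have -> : D (fun y => D (energy_rep A H g) y W) x0 = D (l \+ (fun y => - K (projH E y))) x0.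
  apply: D_near => //; apply: filterS (open_near oV Ux0) => y Uy; exact: WE.
have -> : D (l \+ (fun y => - K (projH E y))) x0 = D l x0 + D (fun y => - K (projH E y)) x0.
  exact: D_add.
rewrite clinD D_clin /l ccompE xi_partE DN clinN.
have -> : D (fun y => K (projH E y)) x0 V = 0.
  have pV : projH E V = 0 by rewrite projHE.
  by rewrite [LHS]DKp pV clin_map0.
by rewrite subr0.
Qed.

Lemma tcoord_PG (p q : G * (E * dual E)) w : dom A p.1 q.1 ->
  tcoord (PG_atlas A) q p q w = (tcoord A q.1 p.1 q.1 w.1, w.2).
Proof.
move=> pq; have vv := prod_manifold (vec_manifold E) (vec_manifold (dual E)).
rewrite (tcoord_prod hA vv); [|by split; [exact: dom_self|]|by []].
rewrite (tcoord_prod (vec_manifold E) (vec_manifold (dual E)))//.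
by rewrite !tcoord_vec !idclinE -surjective_pairing.
Qed.

(** In a chart, the tangent space to the graph of [dE] consists of the pairs of [v]
    and the second derivative of the energy at [v], and that of the annihilator contains
    all pairs whose covector kills the directions [(0, (0, c))]. A pair is a sum
    of two such pairs as soon as [c xi] takes the prescribed value for all [c],
    where [v] is [(0, (xi, 0))]; such a [xi] exists by reflexivity. *)
Lemma morse_energy_family :
  morse_family (PG_atlas A) (TG_atlas A) PG_proj (morse_energy H).
Proof.
split; first exact: energy_smooth.
move=> [[g [xi mu]] lambda] /= imz vz [v' lambda'].
pose p := (g, (xi, mu)); pose x0 := chart (PG_atlas A) p p.
have lE : lambda = dfun (PG_atlas A) (morse_energy H) p by [].
pose phi : dual (dual E) := ccomp lambda' (ccomp (cinr E _) (cinr E _)).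
have phiE c : phi c = lambda' (0, (0, c)) by rewrite /phi !ccompE !cinrE.
have [xi1 xi1E] := hE phi.
pose v : (E * (E * dual E))%type := (0, (xi1, 0)).
pose e := energy_rep A H g.
have eE : e = morse_energy H \o unchart (PG_atlas A) p := energy_repE A H g.
exists (v, D (D e) x0 v), (v' - v, lambda' - D (D e) x0 v); split.
- rewrite lE eE; apply: tangent_image_dfun; first exact: PG_manifold.
  exact: energy_smooth.
- have line := @tangent_cotangent_line _ _ _ (PG_atlas A) (PG_manifold hA)
    (vertical_annihilator (PG_atlas A) (TG_atlas A) PG_proj) p lambda
    (lambda' - D (D e) x0 v) (v' - v) _ (open_chart (PG_manifold hA) p).
  apply: line.
  + exact/chart_img/dom_self/PG_manifold.
  + by [].
  + move=> x t Ux q w /= ; rewrite tmap_PG_proj// => -[w1 w21].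
    have pq : dom A p.1 q.1 by have [] := unchart_dom (PG_manifold hA) Ux.
    rewrite ccompE tcoord_PG// w1 clin_map0.
    have -> : w.2 = (0, w.2.2) by rewrite -w21 -surjective_pairing.
    set c := w.2.2.
    rewrite clinD clinZ clinD clinN (_ : lambda (0, (0, c)) = 0); last first.
      by apply: vz; rewrite tmap_PG_proj.
    by rewrite add0r /v /x0 energy_hessian -phiE xi1E subrr scaler0.
- by congr pair; rewrite /= addrC subrK.
Qed.

Lemma tr1E g xi (alpha : dual (E * E)%type) :
  tr1 A ((g, xi), alpha) = ((g, xi),
    (TeR_star A g (ccomp alpha (cinl E E)) + ad_star A xi (ccomp alpha (cinr E E)),
     ccomp alpha (cinr E E))).
Proof.
rewrite /tr1.
have -> : (fun v => alpha (v, 0)) = ccomp alpha (cinl E E).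
  by apply/funext => x; rewrite ccompE cinlE.
have -> : (fun v => alpha (0, v)) = ccomp alpha (cinr E E).
  by apply/funext => x; rewrite ccompE cinrE.
by rewrite !mkclin_id.
Qed.

Lemma TeR_starE g (alpha : dual E) v : TeR_star A g alpha v = alpha (TeR A g v).
Proof. by rewrite /TeR_star mkclin_comp ccompE. Qed.

Lemma dH_dg_rep g mu v : dH_dg A H g mu v = D (H_rep A H g) (chart A g g, mu) (v, 0).
Proof. by rewrite /dH_dg dfunE (dH_dgE hA hH)//; exact: dom_self. Qed.

(** The covectors generated by the energy, computed from the equation
    [lambda (a, b) = mu b + c xi - dH (a, c)] for all [a], [b] and [c]. *)
Lemma generated_energy g xi (alpha : dual (E * E)%type) :
  generated (PG_atlas A) (TG_atlas A) PG_proj (morse_energy H) ((g, xi), alpha) <->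
  exists mu : dual E, xi = dH_dmu H g mu /\
    forall a b, alpha (a, b) = mu b - dH_dg A H g mu a.
Proof.
split.
  move=> [[g1 [xi1 mu]] /= [-> ->] alphaE]; exists mu.
  have {}alphaE a b (c : dual E) : alpha (a, b) =
      mu b + c xi - D (H_rep A H g) (chart A g g, mu) (a, c).
    by have := alphaE (a, (b, c)); rewrite tmap_PG_proj// dfun_energy.
  split.
    apply: dual_separates => c; rewrite (dH_dmu_spec hA hH hE mu c (dom_self hA g)).
    have := alphaE 0 0 c.
    have -> : (0, 0) = 0 :> (E * E)%type by [].
    rewrite !clin_map0 add0r => /esym/eqP; rewrite subr_eq0 => /eqP ->.
    by [].
  move=> a b; rewrite (alphaE a b 0) clin0 addr0 dH_dg_rep.
  by [].
move=> [mu [xiE alphaE]]; exists (g, (xi, mu)) => // -[a [b c]] /=.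
rewrite tmap_PG_proj// dfun_energy//= alphaE -addrA; congr (_ + _).
rewrite xiE (dH_dmu_spec hA hH hE mu c (dom_self hA g)) dH_dg_rep.
by rewrite [in RHS](pairD a c) clin_mapD opprD addrCA subrr addr0.
Qed.


Lemma clin_addI (f g h : dual E) : f + h = g + h -> f = g.
Proof. by move=> /addIr. Qed.

Lemma TeR_starN g (alpha : dual E) : TeR_star A g (- alpha) = - TeR_star A g alpha.
Proof. by apply: clin_ext => v; rewrite clinN !TeR_starE clinN. Qed.

(** The term [ad_star xi mu] occurs on both sides and cancels. *)
Lemma generated_energy_preimage :
  sigmaG A @^-1` (tr1 A @`
    generated (PG_atlas A) (TG_atlas A) PG_proj (morse_energy H)) = S' A H.
Proof.
apply/seteqP; split.
- move=> [[g mu] [xi nu]] [[[g1 xi1] alpha] /generated_energy[mu1 [xiE alphaE]]].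
  rewrite tr1E => e.
  have e1 : g1 = g := congr1 (fun z : TsTG G E => z.1.1) e.
  have e2 : xi1 = xi := congr1 (fun z : TsTG G E => z.1.2) e.
  have e3 := congr1 (fun z : TsTG G E => z.2.1) e.
  have e4 : ccomp alpha (cinr E E) = mu := congr1 (fun z : TsTG G E => z.2.2) e.
  rewrite /= in e3; subst g1.
  have a_xi : ccomp alpha (cinr E E) = mu1.
    by apply: clin_ext => b; rewrite ccompE cinrE alphaE clin_map0 subr0.
  have a_g : ccomp alpha (cinl E E) = - dH_dg A H g mu1.
    by apply: clin_ext => a; rewrite ccompE cinlE alphaE clin_map0 add0r clinN.
  have emu : mu1 = mu by rewrite -a_xi.
  rewrite e4 e2 a_g emu in e3; rewrite emu in xiE.
  have nuE : - TeR_star A g (dH_dg A H g mu) = nu.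
    by rewrite -TeR_starN; exact: clin_addI e3.
  exists (g, mu); first exact: I.
  by rewrite /= nuE -xiE e2.
- move=> _ [[g mu] _ <-] /=.
  pose alpha : dual (E * E)%type := ccomp mu (csnd E E) - ccomp (dH_dg A H g mu) (cfst E E).
  have alphaE a b : alpha (a, b) = mu b - dH_dg A H g mu a.
    by rewrite /alpha clinD clinN !ccompE cfstE csndE.
  exists ((g, dH_dmu H g mu), alpha); first by apply/generated_energy; exists mu.
  rewrite tr1E /sigmaG.
  have -> : ccomp alpha (cinr E E) = mu.
    by apply: clin_ext => b; rewrite ccompE cinrE alphaE clin_map0 subr0.
  have -> : ccomp alpha (cinl E E) = - dH_dg A H g mu.
    by apply: clin_ext => a; rewrite ccompE cinlE alphaE clin_map0 add0r clinN.
  by rewrite TeR_starN.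
Qed.

End MorseFamily.

(** * Right translations *)

Section SmoothPairs.
Context {R : realType}.
Context (T T' T'' : Type) (E E' E'' : normedModType R).
Variables (A : atlas T E) (A' : atlas T' E') (A'' : atlas T'' E'').
Hypotheses (hA : is_manifold A) (hA' : is_manifold A') (hA'' : is_manifold A'').

Lemma smooth_cst (b : T') : smooth A A' (fun=> b).
Proof.
move=> p; exists (chart A p @` dom A p); split.
- exact: open_chart.
- exact/chart_img/dom_self.
- by [].
- by move=> x _; exact: dom_self.
- exact: smooth_on_cst.
Qed.

Lemma smooth_pair (f : T -> T') (g : T -> T'') : smooth A A' f -> smooth A A'' g ->
  smooth A (prod_atlas A' A'') (fun x => (f x, g x)).
Proof.
move=> sf sg p; have [U [oU Up UI Uf sU]] := sf p; have [V [oV Vp _ Vg sV]] := sg p.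
have oUV : open (U `&` V) by exact: openI.
exists (U `&` V); split.
- exact: oUV.
- by [].
- by move=> x [/UI].
- by move=> x [Ux Vx]; split; [exact: Uf|exact: Vg].
- apply: (@smooth_on_pair _ _ _ _ _ (chart A' (f p) \o f \o unchart A p)
    (chart A'' (g p) \o g \o unchart A p)) => //.
    by apply: smooth_on_sub sU => x [].
  by apply: smooth_on_sub sV => x [].
Qed.

Lemma smooth_fst : smooth (prod_atlas A A') A fst.
Proof.
move=> p; pose P := prod_atlas A A'.
have hP : is_manifold P := prod_manifold hA hA'.
exists (chart P p @` dom P p); split.
- exact: open_chart.
- exact/chart_img/dom_self.
- by [].
- by move=> _ [r [p1 p2] <-] /=; rewrite (chartK hA p1).
- apply: (@smooth_on_eq _ _ _ _ fst); first exact: open_chart.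
    by move=> _ [r [p1 p2] <-] /=; rewrite (chartK hA p1).
  exact: smooth_on_fst.
Qed.

Lemma smooth_snd : smooth (prod_atlas A A') A' snd.
Proof.
move=> p; pose P := prod_atlas A A'.
have hP : is_manifold P := prod_manifold hA hA'.
exists (chart P p @` dom P p); split.
- exact: open_chart.
- exact/chart_img/dom_self.
- by [].
- by move=> _ [r [p1 p2] <-] /=; rewrite (chartK hA' p2).
- apply: (@smooth_on_eq _ _ _ _ snd); first exact: open_chart.
    by move=> _ [r [p1 p2] <-] /=; rewrite (chartK hA' p2).
  exact: smooth_on_snd.
Qed.

End SmoothPairs.

Section Translations.
Context {R : realType} (E : normedModType R) (G : groupType) (A : atlas G E).
Hypothesis hG : lie_group A.

Let hA : is_manifold A. Proof. by have [] := hG. Qed.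
Let hAA : is_manifold (prod_atlas A A). Proof. exact: prod_manifold. Qed.
Let smul : smooth (prod_atlas A A) A (fun x => (x.1 * x.2)%g).
Proof. by have [] := hG. Qed.
Let sinv : smooth A A (fun x => x^-1%g). Proof. by have [] := hG. Qed.

Lemma right_mul_smooth (g : G) : smooth A A (fun h => (h * g)%g).
Proof.
have sp := smooth_pair (smooth_id hA) (smooth_cst hA hA g).
exact: (smooth_comp hA hAA hA sp smul).
Qed.

Lemma right_div_smooth : smooth (prod_atlas A A) A (fun x => (x.1 * x.2^-1)%g).
Proof.
have s2 := smooth_comp hAA hA hA (smooth_snd hA hA) sinv.
have sp := smooth_pair (smooth_fst hA hA) s2.
exact: (smooth_comp hAA hAA hA sp smul).
Qed.

(** The tangent maps of right translations, between the identity and a point of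
    the chart of index [g0], as functions of the coordinate of that point; the
    second one is the right invariant Maurer-Cartan form. *)
Definition TeR_rep (g0 : G) (y : E) : clin E E :=
  mder A A 1%g g0 (fun h => (h * unchart A g0 y)%g) 1%g.

Definition MC_rep (g0 : G) (y : E) : clin E E :=
  mder A A g0 1%g (fun h => (h * (unchart A g0 y)^-1)%g) (unchart A g0 y).

(** Partial derivative at the identity of the multiplication. *)
Lemma TeR_rep_smooth g0 : exists U : set E, [/\ open U, U (chart A g0 g0),
  U `<=` chart A g0 @` dom A g0 & smooth_on U (TeR_rep g0)].
Proof.
pose e : G := 1%g.
have d1 : dom (prod_atlas A A) (e, g0) (e, g0) by exact: dom_self.
have d2 : dom A g0 ((e, g0).1 * (e, g0).2)%g by rewrite /= mul1g; exact: (dom_self hA g0).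
have [W [oW Wx WI _ sW]] := smooth_charts hAA hA smul d1 d2.
pose F := chart_rep (prod_atlas A A) A (e, g0) g0 (fun x => (x.1 * x.2)%g).
pose c1 := chart A 1%g 1%g.
pose i : E -> E * E := fun y => (c1, y).
have si (V : set E) : open V -> smooth_on V i.
  by move=> oV; apply: smooth_on_pair => //; [exact: smooth_on_cst|exact: smooth_on_id].
have oU : open (i @^-1` W).
  by have := smooth_on_open_preimage openT oW (si _ openT); rewrite setTI.
exists (i @^-1` W); split => //.
- by move=> y /WI[[r s] [/= _ ds] [_ <-]]; exists s.
- apply: (@smooth_on_eq _ _ _ _ (fun y => ccomp (D F (i y)) (cinl E E))) => //.
    move=> y Wy; apply: clin_ext => v; rewrite ccompE cinlE.
    by rewrite -(D_partial1 _ (smooth_on_differentiable sW Wy)).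
  apply: smooth_on_ccomp => //; last exact: smooth_on_cst.
  by apply: (smooth_on_comp oU _ (si _ oU) (smooth_on_D sW)).
Qed.

(** Division in [G] is smooth, and the form is the partial derivative in [z] of
    [(z, y) |-> z y^-1] at [(y, y)]; no operator is inverted. *)
Lemma MC_rep_smooth g0 : exists U : set E, [/\ open U, U (chart A g0 g0),
  U `<=` chart A g0 @` dom A g0 & smooth_on U (MC_rep g0)].
Proof.
have d1 : dom (prod_atlas A A) (g0, g0) (g0, g0) by exact: dom_self.
have d2 : dom A 1%g ((g0, g0).1 * (g0, g0).2^-1)%g by rewrite /= mulgV; exact: dom_self.
have [W [oW Wx WI _ sW]] := smooth_charts hAA hA right_div_smooth d1 d2.
pose F := chart_rep (prod_atlas A A) A (g0, g0) 1%g (fun x => (x.1 * x.2^-1)%g).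
pose i : E -> E * E := fun y => (y, y).
have si (V : set E) : open V -> smooth_on V i.
  by move=> oV; apply: smooth_on_pair => //; exact: smooth_on_id.
have oU : open (i @^-1` W).
  by have := smooth_on_open_preimage openT oW (si _ openT); rewrite setTI.
have UI y : W (i y) -> (chart A g0 @` dom A g0) y.
  by move=> /WI[[r s] [/= _ ds] [_ <-]]; exists s.
exists (i @^-1` W); split => //.
apply: (@smooth_on_eq _ _ _ _ (fun y => ccomp (D F (i y)) (cinl E E))) => //.
  move=> y Wy; apply: clin_ext => v; rewrite ccompE cinlE.
  rewrite /MC_rep /mder (unchartK hA (UI _ Wy)).
  by rewrite -(D_partial1 _ (smooth_on_differentiable sW Wy)).
apply: smooth_on_ccomp => //; last exact: smooth_on_cst.
by apply: (smooth_on_comp oU _ (si _ oU) (smooth_on_D sW)).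
Qed.

(** The chain rule for the two composites of [h |-> h g] and [h |-> h g^-1]. *)
Lemma right_mul_mderK g0 g : dom A g0 g ->
  ccomp (mder A A 1%g g0 (fun h => (h * g)%g) 1%g)
        (mder A A g0 1%g (fun h => (h * g^-1)%g) g) = idclin E /\
  ccomp (mder A A g0 1%g (fun h => (h * g^-1)%g) g)
        (mder A A 1%g g0 (fun h => (h * g)%g) 1%g) = idclin E.
Proof.
move=> gg; have d1 := dom_self hA 1%g.
pose f h := (h * g)%g; pose f' h := (h * g^-1)%g.
have f'g : f' g = 1%g by rewrite /f' mulgV.
have f1 : f 1%g = g by rewrite /f mul1g.
have ff' : f \o f' = id by apply/funext => h; rewrite /f /f' /= mulgVK.
have f'f : f' \o f = id by apply/funext => h; rewrite /f /f' /= mulgK.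
have sf : smooth A A f := right_mul_smooth g.
have sf' : smooth A A f' := right_mul_smooth g^-1.
split.
- have := @mder_comp _ _ _ _ _ _ _ A A A hA hA hA f' f g0 1%g g0 g sf' sf gg.
  by rewrite f'g f1 ff' (mder_id hA gg) => /(_ d1 gg) <-.
- have := @mder_comp _ _ _ _ _ _ _ A A A hA hA hA f f' 1%g g0 1%g 1%g sf sf' d1.
  by rewrite f1 f'g f'f (mder_id hA d1) => /(_ gg d1) <-.
Qed.

Lemma TeR_MC_rep g0 y : (chart A g0 @` dom A g0) y ->
  ccomp (TeR_rep g0 y) (MC_rep g0 y) = idclin E.
Proof. by move=> /(unchart_dom hA) /right_mul_mderK[]. Qed.

Lemma MC_TeR_rep g0 y : (chart A g0 @` dom A g0) y ->
  ccomp (MC_rep g0 y) (TeR_rep g0 y) = idclin E.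
Proof. by move=> /(unchart_dom hA) /right_mul_mderK[]. Qed.

(** The right invariant Maurer-Cartan form, in centred charts; it inverts [TeR]. *)
Definition MC (g : G) : clin E E := mder A A g 1%g (fun h => (h * g^-1)%g) g.

Lemma TeR_mder g : TeR A g = mder A A 1%g g (fun h => (h * g)%g) 1%g.
Proof. by rewrite /TeR tmapE mul1g. Qed.

Lemma TeR_MC g a : TeR A g (MC g a) = a.
Proof.
have [e _] := right_mul_mderK (dom_self hA g).
by rewrite TeR_mder -ccompE e idclinE.
Qed.

Lemma MC_TeR g a : MC g (TeR A g a) = a.
Proof.
have [_ e] := right_mul_mderK (dom_self hA g).
by rewrite TeR_mder -ccompE e idclinE.
Qed.

Lemma MC_tcoord g0 g : dom A g0 g ->
  ccomp (MC g) (tcoord A g0 g g) = mder A A g0 1%g (fun h => (h * g^-1)%g) g.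
Proof.
move=> gg; rewrite tcoordE /MC.
have d1 : dom A 1%g (g * g^-1)%g by rewrite mulgV; exact: dom_self.
by rewrite -(mder_comp hA hA hA (smooth_id hA) (right_mul_smooth g^-1) gg (dom_self hA g) d1).
Qed.

Lemma TeR_tcoord g0 g : dom A g0 g ->
  ccomp (tcoord A g g0 g) (TeR A g) = mder A A 1%g g0 (fun h => (h * g)%g) 1%g.
Proof.
move=> gg; rewrite tcoordE TeR_mder.
pose f h := (h * g)%g.
have f1 : f 1%g = g by rewrite /f mul1g.
have := @mder_comp _ _ _ _ _ _ _ A A A hA hA hA f id 1%g g g0 1%g
  (right_mul_smooth g) (smooth_id hA) (dom_self hA 1%g).
by rewrite f1 => /(_ (dom_self hA g) gg) <-.
Qed.

End Translations.

(** * The symplectic form *)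

Section SymplecticForm.
Context {R : realType} (E : normedModType R) (G : groupType) (A : atlas G E).
Hypothesis hG : lie_group A.

Let hA : is_manifold A. Proof. by have [] := hG. Qed.

Local Notation M := (TTsG_model E).
Local Notation TM := (TTsG_atlas A).

Definition y_part : clin M E := ccomp (cfst _ _) (cfst _ _).
Definition momentum_part : clin M (dual E) := ccomp (csnd _ _) (cfst _ _).
Definition velocity_part : clin M E := ccomp (cfst _ _) (csnd _ _).
Definition force_part : clin M (dual E) := ccomp (csnd _ _) (csnd _ _).

Lemma y_partE x : y_part x = x.1.1. Proof. by rewrite /y_part ccompE !cfstE. Qed.
Lemma momentum_partE x : momentum_part x = x.1.2.
Proof. by rewrite /momentum_part ccompE csndE cfstE. Qed.
Lemma velocity_partE x : velocity_part x = x.2.1.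
Proof. by rewrite /velocity_part ccompE cfstE csndE. Qed.
Lemma force_partE x : force_part x = x.2.2.
Proof. by rewrite /force_part ccompE !csndE. Qed.

#[global] Opaque y_part momentum_part velocity_part force_part.

Lemma TTsG_manifold : is_manifold TM.
Proof.
apply: prod_manifold; apply: prod_manifold => //; exact: vec_manifold.
Qed.

(** The brackets in the definition cancel: with [xi2 = MC g w.1.1] and
    [xi3 = w.2.1 - [xi, xi2]], the value of the form is
    [<mu, w.2.1> + <nu, xi2>]. *)
Lemma theta2E g mu xi nu w :
  theta2 A ((g, mu), (xi, nu)) w = mu w.2.1 + nu (MC A g w.1.1).
Proof.
pose L : clin M R := ccomp mu velocity_part + ccomp nu (ccomp (MC A g) y_part).
have LE x : L x = mu x.2.1 + nu (MC A g x.1.1).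
  rewrite /L clinD; congr (_ + _); first by rewrite (ccompE mu velocity_part) velocity_partE.
  by rewrite (ccompE nu) (ccompE _ y_part) y_partE.
rewrite -LE /theta2 -[in RHS](mkclin_id L); congr ((mkclin _ : clin M R) w).
apply/funext => x; rewrite LE; apply: get_unique.
  pose xi2 := MC A g x.1.1; pose nu2 := x.1.2 - ad_star A xi2 mu.
  exists xi2, nu2, (x.2.1 - lie_bracket A xi xi2),
    (x.2.2 - ad_star A xi2 nu + ad_star A xi nu2).
  rewrite -/xi2; split; last by rewrite clin_mapB addrAC subrK.
  have e1 : TeR A g xi2 = x.1.1 := TeR_MC hG g x.1.1.
  have e2 : nu2 + ad_star A xi2 mu = x.1.2 by rewrite /nu2 subrK.
  have e3 : x.2.1 - lie_bracket A xi xi2 + lie_bracket A xi xi2 = x.2.1 by rewrite subrK.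
  have e4 : x.2.2 - ad_star A xi2 nu + ad_star A xi nu2 + ad_star A xi2 nu - ad_star A xi nu2
      = x.2.2 by move: (ad_star A xi nu2) (ad_star A xi2 nu) => P Q; rewrite addrAC addrK subrK.
  by rewrite /TTsG_vec e1 e2 e3 e4; case: (x) => [[? ?] [? ?]].
move=> r [xi2 [nu2 [xi3 [nu3 [-> ->]]]]] /=.
by rewrite (MC_TeR hG) clin_mapD addrAC.
Qed.

(* From here on both are used through their characteristic lemmas only. *)
#[global] Opaque theta2 tcoord.

Lemma tcoord_TTsG (p q : TTsG G E) v : dom A p.1.1 q.1.1 ->
  tcoord TM p q q v = ((tcoord A p.1.1 q.1.1 q.1.1 v.1.1, v.1.2), v.2).
Proof.
move=> pq.
have m1 : is_manifold (prod_atlas A (vec_atlas (dual E))) := prod_manifold hA (vec_manifold _).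
have m2 : is_manifold (prod_atlas (vec_atlas E) (vec_atlas (dual E))) :=
  prod_manifold (vec_manifold _) (vec_manifold _).
have qq : dom A q.1.1 q.1.1 := dom_self hA q.1.1.
have E1 := @tcoord_prod _ _ _ _ _ _ _ m1 m2 p q q v
  (conj (conj pq I) (conj I I)) (conj (conj qq I) (conj I I)).
have E2 := @tcoord_prod _ _ _ _ _ _ _ hA (vec_manifold (dual E)) p.1 q.1 q.1 v.1
  (conj pq I) (conj qq I).
have E3 := @tcoord_prod _ _ _ _ _ _ _ (vec_manifold E) (vec_manifold (dual E)) p.2 q.2 q.2 v.2
  (conj I I) (conj I I).
rewrite tcoord_vec idclinE in E2; rewrite !tcoord_vec !idclinE -surjective_pairing in E3.
exact: (etrans E1 (f_equal2 pair E2 E3)).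
Qed.

(** Reading the Maurer-Cartan form in the fixed chart [g0] absorbs the change of
    representative of tangent vectors. *)
Lemma local_theta2 g0 (p : TTsG G E) v x : p.1.1 = g0 -> (chart A g0 @` dom A g0) x.1.1 ->
  local_form TM (theta2 A) p v x =
  x.1.2 v.2.1 + x.2.2 (MC_rep A g0 x.1.1 v.1.1).
Proof.
move=> <- xI; rewrite /local_form.
have pq := unchart_dom hA xI.
rewrite [unchart TM p x]/=.
rewrite theta2E tcoord_TTsG//=; congr (_ + x.2.2 _).
by rewrite -ccompE (MC_tcoord hG pq).
Qed.

(** The form [d (<mu, d xi> + <nu, K dy>)], where [y] is the coordinate on [G] and
    [K] the Maurer-Cartan form in the chart. *)
Lemma ext_deriv_theta2 (p : TTsG G E) (u v : M) :
  let K := MC_rep A p.1.1 in let y := chart A p.1.1 p.1.1 in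
  ext_deriv TM (theta2 A) p u v =
    (u.1.2 v.2.1 + (p.2.2 (D K y u.1.1 v.1.1) + u.2.2 (K y v.1.1))) -
    (v.1.2 u.2.1 + (p.2.2 (D K y v.1.1 u.1.1) + v.2.2 (K y u.1.1))).
Proof.
move=> K y.
have [U [oU Uy UI sU]] := MC_rep_smooth hG p.1.1.
pose x0 := chart TM p p.
have dK : differentiable K y := smooth_on_differentiable sU Uy.
have Kx0 : y_part x0 = y by rewrite y_partE.
suff main u' v' : 'd (local_form TM (theta2 A) p v') x0 u' =
    u'.1.2 v'.2.1 + (p.2.2 (D K y u'.1.1 v'.1.1) + u'.2.2 (K y v'.1.1)).
  by rewrite /ext_deriv !main.
pose l1 (x : M) := momentum_part x v'.2.1.
pose f2 (x : M) := K (y_part x) v'.1.1.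
have [d1 D1] := D_apply v'.2.1 u' (differentiable_clin momentum_part x0).
have dKv : differentiable (fun z => K z v'.1.1) (y_part x0).
  by rewrite Kx0; have [] := D_apply v'.1.1 0 dK.
have [df2 Df2] := D_comp_clin u' dKv.
have [d2 D2] := differentiable_eval (differentiable_clin force_part x0) df2.
have dl : differentiable (l1 \+ (fun x => force_part x (f2 x))) x0.
  exact: differentiableD.
have near_eq : {near x0, l1 \+ (fun x => force_part x (f2 x)) =1
    local_form TM (theta2 A) p v'}.
  have oV : open (y_part @^-1` U) by apply: open_comp => // x _; exact: clin_continuous.
  have Ux0 : U (y_part x0) by rewrite Kx0.
  apply: filterS (open_near oV Ux0) => x Ux.
  rewrite (local_theta2 _ (erefl p.1.1)); last by rewrite -y_partE; exact: UI.
  by rewrite -(momentum_partE x) -(force_partE x) -(y_partE x).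
have [dth Dth] := near_differentiable near_eq dl.
rewrite -(DE dth) Dth.
have -> : D (l1 \+ (fun x => force_part x (f2 x))) x0 =
  D l1 x0 + D (fun x => force_part x (f2 x)) x0 := D_add d1 d2.
rewrite clinD; congr (_ + _).
  by rewrite [LHS]D1 D_clin momentum_partE.
rewrite [LHS]D2; congr (_ + _).
  rewrite force_partE; congr (p.2.2 _).
  rewrite [LHS]Df2 Kx0 y_partE.
  by have [_ ->] := D_apply v'.1.1 u'.1.1 dK.
by rewrite D_clin force_partE /f2 Kx0.
Qed.

End SymplecticForm.

(** * Graphs as submanifolds *)

Lemma range_graphE (X Y : Type) (f : X -> Y) a w :
  range (fun x => (x, f x)) (a, w) <-> w = f a.
Proof. by split=> [[x _ [<- <-]]|->] //; exists a. Qed.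

Section GraphSubmanifold.
Context {R : realType} (T : Type) (X Y : normedModType R).
Variable A : atlas T (X * Y)%type.
Hypothesis hA : is_manifold A.

Definition local_graph (S : set T) (p : T) (U : set X) (F : X -> Y) : Prop :=
  [/\ open U, U (chart A p p).1, smooth_on U F,
      forall x, U x.1 -> (chart A p @` dom A p) x &
      forall x, U x.1 -> (S (unchart A p x) <-> x.2 = F x.1)].

(** The graph of [F] is straightened by [(x, y) |-> (x, y - F x)]. *)
Lemma submanifold_graph (S : set T) :
  (forall p, S p -> exists U F, local_graph S p U F) -> submanifold A S.
Proof.
move=> Sgraph p /Sgraph[U [F [oU Up sF UI US]]].
pose U' : set (X * Y) := @fst X Y @^-1` U.
have oU' : open U' by exact: open_fst_preimage.
have sF1 : smooth_on U' (fun x => F x.1).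
  by apply: (smooth_on_comp oU' _ _ sF) => [x //|]; exact: smooth_on_fst.
pose Phi (x : X * Y) : (X * Y)%type := (x.1, x.2 + - F x.1).
pose Psi (x : X * Y) : (X * Y)%type := (x.1, x.2 + F x.1).
have PhiK : cancel Phi Psi by move=> [x y]; rewrite /Phi /Psi /= subrK.
have PsiK : cancel Psi Phi by move=> [x y]; rewrite /Phi /Psi /= addrK.
exists X, Y, U', U', Phi, Psi; split; [|split; [|split]].
- by split => //; move=> x; exact: UI.
- split; [exact: oU'| |by move=> x _; exact: PhiK].
  by apply/seteqP; split=> [_ [x Ux <-]//|x Ux]; exists (Psi x).
- apply: (@smooth_on_pair _ _ _ _ U' fst (fun x => x.2 + - F x.1) oU').
    exact: smooth_on_fst.
  apply: (@smooth_on_add _ _ _ U' snd (fun x => - F x.1) oU').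
    exact: smooth_on_snd.
  exact: smooth_on_opp.
- apply: (@smooth_on_pair _ _ _ _ U' fst (fun x => x.2 + F x.1) oU').
    exact: smooth_on_fst.
  apply: (@smooth_on_add _ _ _ U' snd (fun x => F x.1) oU' _ sF1).
  exact: smooth_on_snd.
- move=> x Ux; split=> [/(US _ Ux) xE|/eqP]; first by rewrite /Phi /= xE subrr.
  by rewrite /Phi /= subr_eq0 => /eqP xE; apply/(US _ Ux).
Qed.

(** A curve in the graph satisfies [gam.2 = F gam.1] near [0]; conversely
    [t |-> (x + t v.1, F (x + t v.1))] is a curve in the graph. *)
Lemma tangent_graph (S : set T) p U F v : local_graph S p U F -> S p ->
  (tangent A S p v <-> v.2 = D F (chart A p p).1 v.1).
Proof.
move=> [oU Up sF UI US] Sp; pose x0 := chart A p p.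
have pp := dom_self hA p.
have dF : differentiable F x0.1 := smooth_on_differentiable sF Up.
have x0F : x0.2 = F x0.1 by apply/(US x0 Up); rewrite /x0 (chartK hA pp).
split.
- move=> [c [c0 cS dc]].
  pose gam : R -> (X * Y)%type := chart A p \o c.
  have dgam : differentiable gam (0 : R).
    by apply/derivable1_diffP; have := @ex_derive _ _ _ _ _ _ _ dc.
  have vE : D gam (0 : R) (1 : R) = v.
    rewrite DE// -deriveE//; exact: (@derive_val _ _ _ _ _ _ _ dc).
  have gam0 : gam 0 = x0 by rewrite /gam /= c0.
  have gamU : \forall t \near (0 : R), U (gam t).1.
    have := differentiable_continuous dgam.
    move=> /(_ (@fst X Y @^-1` U)); apply.
    rewrite gam0; exact: (@open_near _ _ (@fst X Y @^-1` U) x0 (open_fst_preimage oU) Up).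
  have gamF : {near (0 : R), csnd X Y \o gam =1 F \o (cfst X Y \o gam)}.
    apply: filterS2 cS gamU => t [Sct dct] Ut /=.
    rewrite csndE cfstE; apply/(US _ Ut).
    by rewrite /gam /= (chartK hA dct).
  have d2 : differentiable (csnd X Y \o gam) (0 : R).
    by apply: differentiable_comp; last exact: differentiable_clin.
  have d1 : differentiable (cfst X Y \o gam) (0 : R).
    by apply: differentiable_comp; last exact: differentiable_clin.
  have fst0 : (cfst X Y \o gam) 0 = x0.1 by rewrite /= cfstE gam0.
  have dF' : differentiable F ((cfst X Y \o gam) 0) by rewrite fst0.
  have e2 : D (csnd X Y \o gam) 0 = ccomp (csnd X Y) (D gam 0).
    by rewrite (D_comp dgam (differentiable_clin _ _)) D_clin.
  have e1 : D (cfst X Y \o gam) 0 = ccomp (cfst X Y) (D gam 0).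
    by rewrite (D_comp dgam (differentiable_clin _ _)) D_clin.
  have := D_near gamF d2.
  rewrite (D_comp d1 dF') e1 e2 fst0 => /(congr1 (fun L : clin R Y => L 1)).
  by rewrite !ccompE vE csndE cfstE.
- move=> vE; pose gamF (y : X) : (X * Y)%type := (y, F y).
  have DgF : differentiable gamF x0.1 /\ D gamF x0.1 v.1 = v.
    have [d1 D1] := D_id x0.1; split; first exact: (differentiable_pair d1 dF).
    have -> : D gamF x0.1 v.1 = (D id x0.1 v.1, D F x0.1 v.1) := D_pair _ d1 dF.
    by rewrite D1 idclinE -vE -surjective_pairing.
  have gI t : U (x0.1 + t *: v.1) -> (chart A p @` dom A p) (gamF (x0.1 + t *: v.1)).
    by move=> Ut; exact: UI.
  exists (fun t => unchart A p (gamF (x0.1 + t *: v.1))); split.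
  + by rewrite line0 /gamF -x0F -surjective_pairing (chartK hA pp).
  + apply: filterS (line_near v.1 oU Up) => t Ut; split.
      by apply/(US (gamF _) Ut).
    exact/(unchart_dom hA)/gI.
  + rewrite -{2}(DgF.2); apply: (is_derive_curve DgF.1).
    apply: filterS (line_near v.1 oU Up) => t Ut /=.
    by rewrite (unchartK hA (gI _ Ut)).
Qed.

End GraphSubmanifold.

(** * The Lagrangian submanifold *)

Section Lagrangian.
Context {R : realType} (E : normedModType R) (G : groupType) (A : atlas G E).
Hypotheses (hG : lie_group A) (hE : reflexive_space E).
Variable H : G * dual E -> R.
Hypothesis hH : smooth (prod_atlas A (vec_atlas (dual E))) (vec_atlas R) H.

Let hA : is_manifold A. Proof. by have [] := hG. Qed.

Local Notation M := (TTsG_model E).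
Local Notation TM := (TTsG_atlas A).

(** The covector [TeR_star g (dH_dg g mu)] is the differential at the identity of
    [h |-> H (h g, mu)], which can be computed through the chart of index [g0]. *)
Lemma dH_dg_TeR g0 g mu : dom A g0 g ->
  TeR_star A g (dH_dg A H g mu) =
  ccomp (ccomp (D (H_rep A H g0) (chart A g0 g, mu)) (cinl E (dual E)))
        (mder A A 1%g g0 (fun h => (h * g)%g) 1%g).
Proof.
move=> gg; apply: clin_ext => v; rewrite [LHS]TeR_starE.
pose f h := H (h, mu).
have sf : smooth A (vec_atlas R) f.
  have sp := smooth_pair (smooth_id hA) (smooth_cst hA (vec_manifold (dual E)) mu).
  exact: (smooth_comp hA (cotG_manifold hA) (vec_manifold R) sp hH).
have e : dH_dg A H g mu = ccomp (mder A (vec_atlas R) g0 (f g) f g) (tcoord A g g0 g).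
  rewrite tcoordE -(mder_comp (p'' := f g) hA hA (vec_manifold R) (smooth_id hA) sf
    (dom_self hA g) gg I).
  exact: dfunE.
have e2 : ccomp (dH_dg A H g mu) (TeR A g) =
    ccomp (mder A (vec_atlas R) g0 (f g) f g) (mder A A 1%g g0 (fun h => (h * g)%g) 1%g).
  by rewrite e -ccompA (TeR_tcoord hG gg).
transitivity (ccomp (dH_dg A H g mu) (TeR A g) v); first exact: (esym (ccompE _ _ _)).
rewrite e2 [LHS]ccompE [RHS]ccompE [RHS]ccompE cinlE.
exact: (dH_dgE hA hH mu _ gg).
Qed.

(** The set [S'] is in a chart the graph of
    [(y, mu) |-> (D_mu H, - D_y H o TeR_rep y)]. *)
Lemma S'_local_graph g0 mu0 z : exists (J : clin (dual (dual E)) E) (U : set (E * dual E)),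
  let Dh := D (H_rep A H g0) in
  let F x : (E * dual E)%type := (J (ccomp (Dh x) (cinr E (dual E))),
    - ccomp (ccomp (Dh x) (cinl E (dual E))) (TeR_rep A g0 x.1)) in
  [/\ forall phi (nu : dual E), nu (J phi) = phi nu,
      smooth_on U (H_rep A H g0) &
      @local_graph R _ (E * dual E)%type (E * dual E)%type TM (S' A H) ((g0, mu0), z) U F].
Proof.
have [J JE] := reflexive_inverse hE.
have [U1 [oU1 Ux1 U1I sU1]] := H_rep_smooth hA hH mu0 (dom_self hA g0).
have [U2 [oU2 Ux2 U2I sU2]] := TeR_rep_smooth hG g0.
pose U : set (E * dual E) := U1 `&` (@fst E (dual E) @^-1` U2).
have oU : open U by apply: openI => //; exact: open_fst_preimage.
have UU1 : U `<=` U1 by move=> x [].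
exists J, U => Dh F.
have sH : smooth_on U (H_rep A H g0) := smooth_on_sub UU1 sU1.
have sDh : smooth_on U Dh := smooth_on_D sH.
split => //; split => //.
- apply: (smooth_on_pair oU).
    apply: (smooth_on_lin_comp _ oU).
    by apply: (smooth_on_ccomp oU sDh); exact: smooth_on_cst.
  apply: (smooth_on_opp oU); apply: (smooth_on_ccomp oU).
    by apply: (smooth_on_ccomp oU sDh); exact: smooth_on_cst.
  apply: (@smooth_on_comp _ _ _ _ _ U2 fst (TeR_rep A g0)) => //; first by move=> x [].
  exact: smooth_on_fst.
- move=> [[y mu] [b s]] [/= _ /U2I [g gg <-]].
  by exists ((g, mu), (b, s)) => //; split; split.
- move=> [[y mu] w] [/= U1y /U2I [g gg yE]]; rewrite -yE in U1y *.
  have Fg : F (chart A g0 g, mu) = (dH_dmu H g mu, - TeR_star A g (dH_dg A H g mu)).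
    rewrite /F (dH_dg_TeR mu gg) /TeR_rep (chartK hA gg); congr pair.
    apply: dual_separates => nu; rewrite JE ccompE cinrE.
    by rewrite (dH_dmu_spec hA hH hE mu nu gg).
  rewrite Fg [unchart _ _ _]/= (chartK hA gg) -[(w.1, w.2)]surjective_pairing.
  exact: (range_graphE (fun x : G * dual E =>
    (dH_dmu H x.1 x.2, - TeR_star A x.1 (dH_dg A H x.1 x.2))) (g, mu) w).
Qed.

End Lagrangian.

Section LagrangianProof.
Context {R : realType} (E : normedModType R) (G : groupType) (A : atlas G E).
Hypotheses (hG : lie_group A) (hE : reflexive_space E).
Variable H : G * dual E -> R.
Hypothesis hH : smooth (prod_atlas A (vec_atlas (dual E))) (vec_atlas R) H.

Let hA : is_manifold A. Proof. by have [] := hG. Qed.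

Local Notation TM := (TTsG_atlas A).

(** The derivative of the function [F] whose graph is [S'], in terms of the second
    derivative [B] of the Hamiltonian. For the second component one differentiates
    the identity [F2 (K a) = - D_y H a], so that the derivative of the inverse of
    [K] never appears; this produces the term in the derivative of [K], which the
    symplectic form contains as well. *)
Lemma S'_graph_differential (p : TTsG G E) : S' A H p ->
  let x := (chart TM p p).1 in let K := MC_rep A p.1.1 in
  exists U F (B : clin (E * dual E)%type (dual (E * dual E)%type)),
  [/\ @local_graph R _ (E * dual E)%type (E * dual E)%type TM (S' A H) p U F,
      forall w w', B w w' = B w' w,
      forall w (rho : dual E), rho (D F x w).1 = B w (0, rho) &
      forall w a, (D F x w).2 (K x.1 a) + p.2.2 (D K x.1 w.1 a) = - B w (a, 0)].
Proof.
case: p => -[g0 mu0] z Sp x K.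
have [J [U]] := S'_local_graph hG hE hH g0 mu0 z.
set Dh := D (H_rep A H g0) => -[JE sH lg].
move: (lg) => [oU Ux sF UI US]; move: Ux sF US.
set F := fun _ => _; move=> Ux sF US.
have xE : x = (chart A g0 g0, mu0) by [].
pose F1 x' : E := J (ccomp (Dh x') (cinr E (dual E))).
pose F2 x' : dual E := - ccomp (ccomp (Dh x') (cinl E (dual E))) (TeR_rep A g0 x'.1).
have FE x' : F x' = (F1 x', F2 x') by [].
have sF1 : smooth_on U F1.
  apply: (@smooth_on_eq _ _ _ U (fun x' => cfst E (dual E) (F x')) _ oU).
    by move=> x' _; rewrite cfstE.
  exact: smooth_on_lin_comp.
have sF2 : smooth_on U F2.
  apply: (@smooth_on_eq _ _ _ U (fun x' => csnd E (dual E) (F x')) _ oU).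
    by move=> x' _; rewrite csndE.
  exact: smooth_on_lin_comp.
have dF1 : differentiable F1 x := smooth_on_differentiable sF1 Ux.
have dF2 : differentiable F2 x := smooth_on_differentiable sF2 Ux.
have DF w : D F x w = (D F1 x w, D F2 x w) := D_pair w dF1 dF2.
have dDh : differentiable Dh x := smooth_on_differentiable (smooth_on_D sH) Ux.
have zE : z.2 = F2 x.
  have zF : z = F x.
    have := (US (chart TM ((g0, mu0), z) ((g0, mu0), z)) Ux).1.
    rewrite (chartK (TTsG_manifold hG) (dom_self (TTsG_manifold hG) _)) => /(_ Sp).
    by rewrite /= -surjective_pairing.
  by rewrite zF.
exists U, F, (D Dh x); split.
- exact: lg.
- by move=> w w'; exact: (D2_sym w w' oU sH Ux).
- move=> w rho; rewrite DF.
  have [dA DA] := D_apply ((0, rho) : (E * dual E)%type) w dDh.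
  have e : D (rho \o F1) x = ccomp rho (D F1 x).
    by rewrite (D_comp dF1 (differentiable_clin _ _)) D_clin.
  have e' : rho \o F1 = fun x' => Dh x' (0, rho).
    by apply/funext => x'; rewrite /F1 /= JE ccompE cinrE.
  by rewrite -DA -e' e ccompE.
- move=> w a; rewrite DF zE.
  have [V [oV Vx VI sV]] := MC_rep_smooth hG g0.
  have dK : differentiable K (cfst E (dual E) x).
    by rewrite cfstE; exact: smooth_on_differentiable sV Vx.
  have [dKa DKa] := D_apply a (cfst E (dual E) w) dK.
  have [dKp DKp] := D_comp_clin w dKa.
  have [dev Dev] := differentiable_eval dF2 dKp.
  have [dA DA] := D_apply ((a, 0) : (E * dual E)%type) w dDh.
  have [dN DN] := D_opp dA.
  have near_eq : {near x, (fun x' => F2 x' (K (cfst E (dual E) x') a)) =1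
      (fun x' => - Dh x' (a, 0))}.
    have oW : open (@fst E (dual E) @^-1` V) by exact: open_fst_preimage.
    have := @open_near _ _ (@fst E (dual E) @^-1` V) x oW Vx; apply: filterS => x' Vx'.
    rewrite cfstE /F2 clinN [ccomp _ _ _]ccompE [ccomp _ _ _]ccompE.
    rewrite -(ccompE (TeR_rep A g0 x'.1)) (TeR_MC_rep hG (VI _ Vx')).
    by rewrite idclinE cinlE.
  have De := D_near near_eq dev.
  have De2 : D (fun x' => F2 x' (K (cfst E (dual E) x') a)) x w = - D Dh x w (a, 0).
    by rewrite De DN clinN; congr (- _); exact: DA.
  apply: etrans De2; apply: etrans (esym (Dev w)).
  rewrite addrC; congr (F2 x _ + _); last by rewrite cfstE.
  by rewrite [RHS]DKp DKa !cfstE.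
Qed.

(** For [u] tangent to the graph of [F] and any [v], the form only sees the
    difference between [v] and the tangent vector to the graph with the same base
    component; the remaining terms cancel by the symmetry of [B]. *)
Lemma omega_graph (DF : clin (E * dual E)%type (E * dual E)%type)
  (B : clin (E * dual E)%type (dual (E * dual E)%type))
  (K : clin E E) (DK : clin E (clin E E)) (nu : dual E) (u v : TTsG_model E) :
  (forall w w', B w w' = B w' w) ->
  (forall w (rho : dual E), rho (DF w).1 = B w (0, rho)) ->
  (forall w a, (DF w).2 (K a) + nu (DK w.1 a) = - B w (a, 0)) ->
  u.2 = DF u.1 ->
  (u.1.2 v.2.1 + (nu (DK u.1.1 v.1.1) + u.2.2 (K v.1.1))) -
  (v.1.2 u.2.1 + (nu (DK v.1.1 u.1.1) + v.2.2 (K u.1.1))) =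
  u.1.2 (v.2.1 - (DF v.1).1) - (v.2.2 - (DF v.1).2) (K u.1.1).
Proof.
move=> Bsym DF1 DF2 ->.
have e1 := DF2 u.1 v.1.1; have e2 := DF1 u.1 v.1.2.
have e3 := DF2 v.1 u.1.1; have e4 := DF1 v.1 u.1.2.
have Bs : B u.1 (v.1.1, 0) + B u.1 (0, v.1.2) = B v.1 (u.1.1, 0) + B v.1 (0, u.1.2).
  by rewrite -!clin_mapD -!pairD -!surjective_pairing.
rewrite clin_mapB clinD clinN e4 e2.
move: e1 e3 Bs.
move: ((DF u.1).2 (K v.1.1)) (nu (DK u.1.1 v.1.1)) (B u.1 (v.1.1, 0)) => x1 x2 x3.
move: ((DF v.1).2 (K u.1.1)) (nu (DK v.1.1 u.1.1)) (B v.1 (u.1.1, 0)) => x4 x5 x6.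
move: (B u.1 (0, v.1.2)) (B v.1 (0, u.1.2)) (u.1.2 v.2.1) (v.2.2 (K u.1.1)) => x7 x8 x9 x10.
by move=> /= e1 e3 Bs; lra.
Qed.

(** A vector orthogonal to all tangent vectors of [S'] is tangent: the difference
    in [omega_graph] is orthogonal to all [u.1], hence zero, because the dual
    separates points and the Maurer-Cartan form is onto. *)
Lemma S'_lagrangian : lagrangian TM (ext_deriv TM (theta2 A)) (S' A H).
Proof.
have hTM := TTsG_manifold hG.
split.
  apply: (@submanifold_graph _ _ (E * dual E)%type (E * dual E)%type TM) => p Sp.
  by have [U [F [B [lg _ _ _]]]] := S'_graph_differential Sp; exists U, F.
move=> p Sp v.
have [U [F [B [lg Bsym DF1 DF2]]]] := S'_graph_differential Sp.
pose x := (chart TM p p).1; pose K := MC_rep A p.1.1.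
have tangentE u : tangent TM (S' A H) p u <-> u.2 = D F x u.1.
  exact: (@tangent_graph _ _ _ _ TM hTM _ _ _ _ u lg Sp).
have omegaE u : u.2 = D F x u.1 -> ext_deriv TM (theta2 A) p u v =
    u.1.2 (v.2.1 - (D F x v.1).1) - (v.2.2 - (D F x v.1).2) (K x.1 u.1.1).
  move=> uT; rewrite (ext_deriv_theta2 hG).
  exact: (@omega_graph (D F x) B (K x.1) (D K x.1) p.2.2 u v Bsym DF1 DF2 uT).
split.
  move=> /tangentE vT u /tangentE /omegaE ->.
  by rewrite vT !subrr clin_map0 clin0 subrr.
move=> vO; apply/tangentE.
have orth (w : (E * dual E)%type) :
    w.2 (v.2.1 - (D F x v.1).1) - (v.2.2 - (D F x v.1).2) (K x.1 w.1) = 0.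
  pose u : TTsG_model E := (w, D F x w).
  by rewrite -(omegaE u)//; apply: vO; apply/tangentE.
have e1 : v.2.1 = (D F x v.1).1.
  apply: dual_separates => rho; apply/eqP; rewrite -subr_eq0 -clin_mapB.
  have := orth (0, rho); rewrite -[(0, rho).2]/rho -[(0, rho).1]/(0 : E).
  by rewrite !clin_map0 subr0 => ->.
have e2 : v.2.2 = (D F x v.1).2.
  apply: clin_ext => b; apply/eqP; rewrite -subr_eq0.
  have yI : (chart A p.1.1 @` dom A p.1.1) x.1 by exact/chart_img/dom_self.
  have KT : K x.1 (TeR_rep A p.1.1 x.1 b) = b.
    by rewrite -ccompE (MC_TeR_rep hG yI) idclinE.
  have o : (0 : dual E) (v.2.1 - (D F x v.1).1) -
      (v.2.2 - (D F x v.1).2) (K x.1 (TeR_rep A p.1.1 x.1 b)) = 0.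
    exact: (orth (TeR_rep A p.1.1 x.1 b, 0)).
  rewrite KT clin0 sub0r clinD clinN in o.
  by move/eqP: o; rewrite oppr_eq0.
by rewrite [LHS]surjective_pairing e1 e2 -surjective_pairing.
Qed.

End LagrangianProof.

Theorem mainTheorem6 (R : realType) (E : completeNormedModType R)
  (G : groupType) (A : atlas G E) (hG : lie_group A)
  (hE : reflexive_space E)
  (H : G * dual E -> R)
  (hH : smooth (prod_atlas A (vec_atlas (dual E))) (vec_atlas R) H) :
  [/\ morse_family (PG_atlas A) (TG_atlas A) PG_proj (morse_energy H),
      sigmaG A @^-1` (tr1 A @`
        generated (PG_atlas A) (TG_atlas A) PG_proj (morse_energy H))
      = S' A H &
      lagrangian (TTsG_atlas A) (ext_deriv (TTsG_atlas A) (theta2 A)) (S' A H)].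
Proof.
have [hA _ _] := hG; split.
- exact (morse_energy_family hA hE hH).
- exact (generated_energy_preimage hA hE hH).
- exact (S'_lagrangian hG hE hH).
Qed.
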